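(* Let $k\ge1$, $\mathbf x=(x_1,\dots,x_k)\in(\mathbb Z^d)^k$ and $\phi\in\mathcal S(\mathbb R^d)$. For the system of independent random walkers started from $\nu_\rho$, the $k$-th order fluctuation field $X_N(\mathbf x,\eta,\phi)=\sum_{z\in\mathbb Z^d}\phi(\tfrac zN)D(\hat\tau_z\mathbf x,\eta)$ is such that for all $T>0$ there exists $C(T)$ such that for all $N$ big enough $$\frac1{N^d}\int_0^T\int_0^T\mathbb E_{\nu_\rho}\left[X_N(\mathbf x,\eta(N^2t),\phi)\,X_N(\mathbf x,\eta(N^2s),\phi)\right]ds\,dt\le C(T)\,N^{-\frac{2(k-1)d}{2+(k-1)d}}.$$
   Context: Fix $d\ge1$; $\mathbb N=\{0,1,2,\dots\}$; $\mathcal S(\mathbb R^d)$ is the space of (real) Schwartz functions. Let $p(i,j)$, $i,j\in\mathbb Z^d$, be a Markov transition function with $p(i,j)=p(j,i)=p(0,j-i)$, $\sum_jp(i,j)=1$, of finite range ($p(i,j)=0$ for $|i-j|>R$, some $R>0$), and irreducible. Independent random walkers: the Markov process $\{\eta(t):t\ge0\}$ on $\Omega=\mathbb N^{\mathbb Z^d}$ with generator $\mathcal Lf(\eta)=\sum_{i,j}p(i,j)\eta_i(f(\eta^{ij})-f(\eta))$ on local functions, where $\eta^{ij}$ is $\eta$ with one particle moved from $i$ to $j$; thus each particle independently performs a rate-1 continuous-time random walk with jump kernel $p$. The process is started from configurations for which it is well defined (a set of full $\nu_\rho$-measure). For $\rho>0$, $\nu_\rho$ is the homogeneous product measure on $\Omega$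 with Poisson($\rho$) marginals, which is reversible; $\mathbb E_{\nu_\rho}$ is expectation for the process with $\eta(0)\sim\nu_\rho$. The orthogonal self-duality function is $D(\xi,\eta)=\prod_xd(\xi_x,\eta_x)$ for configurations $\xi$ with finitely many particles, with the Charlier polynomials $d(k,n)=\sum_{j=0}^k\binom kj(-\rho)^{-j}\frac{n!}{(n-j)!}$ (with $\frac{n!}{(n-j)!}=0$ for $j>n$). For $\mathbf x=(x_1,\dots,x_k)\in(\mathbb Z^d)^k$, $D(\mathbf x,\eta):=D(\sum_{i=1}^k\delta_{x_i},\eta)$ and $\hat\tau_z\mathbf x=(z+x_1,\dots,z+x_k)$. The constant $C(T)$ may depend on the fixed data $k,\mathbf x,\phi,\rho,d,p$, but not on $N$. *)

(* Defs.v *)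
From HB Require Import structures.
From mathcomp Require Import all_boot all_order all_algebra.
From mathcomp Require Import all_classical all_reals all_analysis.

Set Implicit Arguments.
Unset Strict Implicit.
Unset Printing Implicit Defensive.

Import Order.TTheory GRing.Theory Num.Theory.
Import numFieldNormedType.Exports.

Local Open Scope classical_set_scope.
Local Open Scope card_scope.
Local Open Scope ring_scope.

Notation lattice d := 'rV[int]_d.

Definition embed (R : realType) (d : nat) (z : lattice d) : 'rV[R]_d :=
  map_mx intr z.

(* Unconditional sum of a real family; meaningful when it is absolutely
   summable. *)
Definition rsum (R : realType) (S : choiceType) (f : S -> R) : R :=
  fine (\esum_(i in [set: S]) (f^\+ i)%:E)
  - fine (\esum_(i in [set: S]) (f^\- i)%:E).

Definition iter_partial (R : realType) (d : nat) (s : seq 'I_d)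
    (phi : 'rV[R]_d -> R) : 'rV[R]_d -> R :=
  foldr (fun i g => 'D_(delta_mx 0 i : 'rV[R]_d) g) phi s.

Definition schwartz (R : realType) (d : nat) (phi : 'rV[R]_d -> R) : Prop :=
  (forall (s : seq 'I_d) (x : 'rV[R]_d), differentiable (iter_partial s phi) x)
  /\
  (forall (a : 'I_d -> nat) (s : seq 'I_d), exists C : R,
     forall x : 'rV[R]_d,
       `|(\prod_(i < d) x 0 i ^+ a i) * iter_partial s phi x| <= C).

Fixpoint nstep (R : realType) (d : nat) (p : lattice d -> lattice d -> R)
    (n : nat) (i j : lattice d) : R :=
  if n is m.+1 then rsum (fun l => p i l * nstep p m l j) else (i == j)%:R.

Record jump_kernel (R : realType) (d : nat)
    (p : lattice d -> lattice d -> R) : Prop := JumpKernel {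
  jk_ge0 : forall i j, 0 <= p i j ;
  jk_sym : forall i j, p i j = p j i ;
  jk_transl : forall i j, p i j = p 0 (j - i) ;
  jk_sum1 : forall i, (\esum_(j in [set: lattice d]) (p i j)%:E = 1)%E ;
  (* [`|_|] is the sup norm; the choice of norm only affects the range *)
  jk_range : exists2 r : R, 0 < r &
    forall i j, r < `|embed R (i - j)| -> p i j = 0 ;
  jk_irr : forall i j, exists n, 0 < nstep p n i j
}.

(* Transition probabilities exp (t (p - 1)) of the rate-1 walk: the number of
   jumps up to time [t] is Poisson of parameter [t]. *)
Definition heat_kernel (R : realType) (d : nat)
    (p : lattice d -> lattice d -> R) (t : R) (i j : lattice d) : R :=
  rsum (fun n : nat => expR (- t) * t ^+ n / n`!%:R * nstep p n i j).

Fixpoint path_weight (R : realType) (d : nat)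
    (p : lattice d -> lattice d -> R) (t : R) (i : lattice d)
    (s : seq (R * lattice d)) : R :=
  if s is (u, j) :: s' then heat_kernel p (u - t) i j * path_weight p u j s'
  else 1.

(* [Y] is a continuous-time Markov chain on [0, oo) with transition function
   [heat_kernel p] and initial state [x]: all its finite-dimensional
   distributions are prescribed. No path regularity is required. *)
Definition random_walk (R : realType) (d : nat)
    (p : lattice d -> lattice d -> R) (disp : measure_display)
    (Om : measurableType disp) (P : probability Om R)
    (x : lattice d) (Y : R -> Om -> lattice d) : Prop :=
  (forall (t : R) y, 0 <= t -> measurable [set w | Y t w = y]) /\
  (forall s : seq (R * lattice d), path <=%R 0 (map fst s) ->
     P [set w | forall u, u \in s -> Y u.1 w = u.2]
     = (path_weight p 0 x s)%:E).

Definition mutually_independent (R : realType) (disp : measure_display)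
    (Om : measurableType disp) (P : probability Om R) (I : choiceType)
    (G : I -> set_system Om) : Prop :=
  forall (J : seq I) (E : I -> set Om), uniq J ->
    (forall i, i \in J -> G i (E i)) ->
    P [set w | forall i, i \in J -> E i w] = (\prod_(i <- J) P (E i))%E.

Definition generated (Om S J : Type) (D : set J) (X : J -> Om -> S) :
    set_system Om :=
  <<s [set E | exists2 j, D j & exists a, E = [set w | X j w = a]] >>.

(* Particles are labelled by [(x, n)], the [n]-th particle initially at [x];
   label [(x, n)] is in use when [n < eta 0 w x]. [iw_init], together with the
   [inl] components of [iw_indep], says that [eta 0] has law nu_rho, the product
   of the Poisson(rho) measures. [eta] is thus the process with generator
   f |-> sum_(i, j) p(i, j) eta_i (f(eta^(ij)) - f(eta)) started from nu_rho. *)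
Record independent_walkers (R : realType) (d : nat)
    (p : lattice d -> lattice d -> R) (rho : R) (disp : measure_display)
    (Om : measurableType disp) (P : probability Om R)
    (eta : R -> Om -> lattice d -> nat)
    (Y : lattice d * nat -> R -> Om -> lattice d) : Prop :=
  IndependentWalkers {
  iw_meas : forall (t : R) x n, 0 <= t -> measurable [set w | eta t w x = n] ;
  iw_init : forall x n,
    P [set w | eta 0 w x = n] = (poisson_pmf rho n)%:E ;
  iw_walk : forall l, random_walk p P l.1 (Y l) ;
  iw_indep : mutually_independent P
    (fun a : lattice d + lattice d * nat =>
       match a with
       | inl x => generated [set 0 : R] (fun t w => eta t w x)
       | inr l => generated [set t : R | 0 <= t] (Y l)
       end) ;
  iw_count : forall t : R, 0 <= t -> {ae P, forall w, forall y,
    [set l : lattice d * nat | (l.2 < eta 0%R w l.1)%N /\ Y l t w = y]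
      #= `I_(eta t w y)}
}.

Definition irw_process (R : realType) (d : nat)
    (p : lattice d -> lattice d -> R) (rho : R) (disp : measure_display)
    (Om : measurableType disp) (P : probability Om R)
    (eta : R -> Om -> lattice d -> nat) : Prop :=
  exists Y, independent_walkers p rho P eta Y.

Definition charlier (R : realType) (rho : R) (k n : nat) : R :=
  \sum_(j < k.+1) 'C(k, j)%:R * (- rho) ^- j * (n ^_ j)%:R.

(* The factors with [xi x = 0] are 1, so the product is finitely supported for
   finite [xi]. *)
Definition duality (R : realType) (d : nat) (rho : R)
    (xi eta : lattice d -> nat) : R :=
  \big[*%R/1]_(x \in [set: lattice d]) charlier rho (xi x) (eta x).

Definition dirac_sum (d k : nat) (x : 'I_k -> lattice d) : lattice d -> nat :=
  fun y => (\sum_(i < k) (x i == y))%N.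

Definition translate (d k : nat) (z : lattice d) (x : 'I_k -> lattice d) :
    'I_k -> lattice d :=
  fun i => z + x i.

Definition fluctuation_field (R : realType) (d k : nat) (rho : R) (N : nat)
    (x : 'I_k -> lattice d) (eta : lattice d -> nat) (phi : 'rV[R]_d -> R) : R :=
  rsum (fun z : lattice d =>
    phi (N%:R^-1 *: embed R z) * duality rho (dirac_sum (translate z x)) eta).

(* Main.v *)
Require Import Defs.
From HB Require Import structures.
From mathcomp Require Import all_boot all_order all_algebra.
From mathcomp Require Import all_classical all_reals all_analysis.
From mathcomp Require Import measurable_realfun.
From mathcomp Require Import ring lra zify.

Set Implicit Arguments.
Unset Strict Implicit.
Unset Printing Implicit Defensive.

Import Order.TTheory GRing.Theory Num.Theory.
Import numFieldNormedType.Exports.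

Local Open Scope classical_set_scope.
Local Open Scope ring_scope.

(** The correlations of the duality functions are explicit. The numbers of
    particles with given sites at the times s <= t are independent Poisson
    variables, and the Charlier polynomials are orthogonal for the Poisson law,
    so that
      E[D(xs, eta_s) D(ys, eta_t)]
        = rho^-k * sum over the permutations sigma of
            prod_i p_(t-s)(xs_i, ys_(sigma i)),
    where p_t is the transition probability of one walk
    ([two_time_charlier_mean]). Since the correlations are nonnegative, in the
    double sum over the translates z and z' one of the k factors can be summed
    over z', which gives at most 1, and the others bounded by their supremum.
    The Schwartz function contributes O(N^d) for the sum over z
    ([schwartz_lattice_sum]). The mean product of the fields at two times with
    lag r, after diffusive rescaling, is therefore at most
    C N^d M^(k-1), where M <= 1 is the supremum of p_(N^2 r).

    The local bound M = O((N^2 r)^(-d/2)) ([heat_kernel_bound]) gives, outside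
    the strip |t - s| < eps, a contribution O((N^2 eps)^(-(k-1)d/2)); the strip
    itself has area O(eps). The choice eps = N^(-2(k-1)d / (2+(k-1)d)) balances
    the two, and is the announced rate.

    For the local bound, irreducibility provides d linearly independent jumps.
    The numbers of jumps of each of these kinds are independent Poisson
    variables, none of which takes a value with probability larger than
    O(t^(-1/2)), and they are determined by the displacement once the other jumps
    are known.

    For the correlation formula, particles are classified by their sites at the
    two times, as far as these lie in a finite set. Factorial moments of the
    class counts are sums over lists of distinct labels, computed from the
    independence of the initial configuration and of the walks
    ([class_draws_mean]); they are those of independent Poisson variables. The
    recursions of the Charlier polynomials and Mecke's formula then give the
    correlations by induction on the number of particles
    ([has_mean_charlier_prod]). Infinite sums of duality functions are reached
    from finite ones by dominated convergence ([mean_product_rsum_le]). *)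

(** * Sums of nonnegative families *)

Section esum_toolbox.
Context {R : realType}.
Local Open Scope ereal_scope.

Lemma esumZl (T : choiceType) (D : set T) (c : R) (a : T -> \bar R) :
  (0 <= c)%R -> (forall i, 0 <= a i) ->
  \esum_(i in D) (c%:E * a i) = c%:E * \esum_(i in D) a i.
Proof.
have half (b : T -> \bar R) (r : R) : (0 <= r)%R -> (forall i, 0 <= b i) ->
    \esum_(i in D) (r%:E * b i) <= r%:E * \esum_(i in D) b i.
  move=> r0 b0; apply: ge_ereal_sup => _ [X [finX XD] <-].
  rewrite -ge0_mule_fsumr//.
  by rewrite lee_wpmul2l ?lee_fin//; apply: esum_ge; exists X.
move=> c0 a0; apply/eqP; rewrite eq_le half//=.
have [->|cn0] := eqVneq c 0%R.
  by rewrite mul0e esum_ge0// => i _; rewrite mul0e.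
have cp : (0 < c)%R by rewrite lt_neqAle eq_sym cn0.
rewrite -lee_pdivlMl//.
apply: le_trans (half (fun i => c%:E * a i) (c^-1)%R _ _).
- by apply: le_esum => i Di; rewrite muleA -EFinM mulVf// mul1e.
- by rewrite invr_ge0.
- by move=> i; rewrite mule_ge0 ?lee_fin.
Qed.

Lemma esumZr (T : choiceType) (D : set T) (c : R) (a : T -> \bar R) :
  (0 <= c)%R -> (forall i, 0 <= a i) ->
  \esum_(i in D) (a i * c%:E) = (\esum_(i in D) a i) * c%:E.
Proof.
move=> c0 a0; rewrite muleC -esumZl//; apply: eq_esum => i _; exact: muleC.
Qed.

Lemma esum_seq_le (T : choiceType) (a : T -> \bar R) (D : set T) (M : \bar R) :
  (forall s : seq T, uniq s -> (forall i, i \in s -> D i) ->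
     \sum_(i <- s) a i <= M) ->
  \esum_(i in D) a i <= M.
Proof.
move=> h; apply: ge_ereal_sup => _ [X [finX XD] <-].
rewrite fsbig_finite//; apply: h; first exact: finmap.fset_uniq.
by move=> i; rewrite in_fset_set// inE => /XD.
Qed.

Lemma le_seq_esum (T : choiceType) (a : T -> \bar R) (s : seq T) (D : set T) :
  uniq s -> (forall i, i \in s -> D i) ->
  \sum_(i <- s) a i <= \esum_(i in D) a i.
Proof.
move=> us sD; apply: esum_ge; exists [set` s]; first by split.
by rewrite -fsbig_seq.
Qed.

Lemma le_term_esum (T : choiceType) (a : T -> \bar R) (D : set T) i :
  D i -> a i <= \esum_(i in D) a i.
Proof.
move=> Di.
by have := @le_seq_esum _ a [:: i] D isT; rewrite big_seq1; apply=> j; rewrite inE => /eqP->.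
Qed.

Lemma le_esum_sub (T : choiceType) (a : T -> \bar R) (D E : set T) :
  D `<=` E -> \esum_(i in D) a i <= \esum_(i in E) a i.
Proof.
move=> DE; apply: esum_seq_le => s us sD; apply: le_seq_esum => // i /sD.
exact: DE.
Qed.

Lemma esum_single (T : choiceType) (f : T -> \bar R) a :
  0 <= f a -> (forall i, i != a -> f i = 0) ->
  \esum_(i in [set: T]) f i = f a.
Proof.
move=> fa0 f0; rewrite -[RHS](esum_set1 fa0) [RHS]esum_mkcond.
apply: eq_esum => i _; have [->|ia] := eqVneq i a; first by rewrite mem_set.
by rewrite f0// memNset// => /eqP; rewrite (negbTE ia).
Qed.

Lemma exchange_esum (T T' : choiceType) (D : set T) (E : set T')
    (a : T -> T' -> \bar R) : (forall i j, 0 <= a i j) ->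
  \esum_(i in D) \esum_(j in E) a i j = \esum_(j in E) \esum_(i in D) a i j.
Proof.
move=> a0; rewrite !esum_esum//.
rewrite (@reindex_esum _ _ _ (E `*`` fun=> D) _ (fun x => (x.2, x.1)))//; split=> //=.
- by move=> [i j] [/= ? ?].
- by move=> [i1 i2] [j1 j2] /= _ _ [] -> ->.
- by move=> [i1 i2] [/= Pi1 Qi2] /=; exists (i2, i1).
Qed.

Lemma reindex_esumT (T T' : choiceType) (h : T -> T') (a : T' -> \bar R) :
  bijective h ->
  \esum_(i in [set: T']) a i = \esum_(i in [set: T]) a (h i).
Proof.
by move=> bh; apply: reindex_esum; rewrite setTT_bijective.
Qed.

Lemma esum_partition (T K : choiceType) (h : T -> K) (D : set T)
    (a : T -> \bar R) : (forall i, 0 <= a i) ->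
  \esum_(i in D) a i =
  \esum_(k in [set: K]) \esum_(i in [set i | D i /\ h i = k]) a i.
Proof.
move=> a0; rewrite esum_esum//.
rewrite (@reindex_esum _ _ _ D _ (fun i => (h i, i)))//; split=> //=.
- by move=> i j _ _ [].
- by move=> [k i] /= [_ [Di <-]]; exists i.
Qed.

(** Enumerating a countable type turns its sums into series, for which
    integration term by term is available. *)
Lemma esum_series (T : countType) (a : T -> \bar R) : (forall i, 0 <= a i) ->
  \esum_(i in [set: T]) a i = \sum_(0 <= n <oo) oapp a 0 (pickle_inv n).
Proof.
move=> a0; rewrite nneseries_esumT; last by move=> n; case: pickle_inv.
rewrite [RHS](esumID [set n | @pickle_inv T n])//; last first.
  by move=> n _; case: pickle_inv.
rewrite [X in _ + X]esum1 ?adde0; last first.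
  by move=> n [_] /=; case: pickle_inv.
rewrite setTI (@reindex_esum _ T nat setT [set n | @pickle_inv T n] pickle).
  by apply: eq_esum => i _; rewrite pickleK_inv.
split.
- by move=> i _ /=; rewrite pickleK_inv.
- move=> i j _ _ /(congr1 (@pickle_inv T)); rewrite !pickleK_inv.
  by case.
- move=> n /=; case E : pickle_inv => [i|//] _; exists i => //.
  by have := @pickle_invK T n; rewrite E.
Qed.

Lemma integral_esum d (Om : measurableType d) (mu : {measure set Om -> \bar R})
  (T : countType) (D : set T) (f : T -> Om -> \bar R) :
  (forall i, measurable_fun setT (f i)) -> (forall i x, 0 <= f i x) ->
  \int[mu]_x (\esum_(i in D) f i x) = \esum_(i in D) \int[mu]_x f i x.
Proof.
move=> mf f0.
pose g i x := if i \in D then f i x else 0.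
have g0 i x : 0 <= g i x by rewrite /g; case: ifP.
have -> : (fun x => \esum_(i in D) f i x) =
    (fun x => \sum_(0 <= n <oo) oapp (g ^~ x) 0 (pickle_inv n)).
  by apply/funext => x; rewrite esum_mkcond (esum_series (fun i => g0 i x)).
have -> : \esum_(i in D) \int[mu]_x f i x =
    \esum_(i in [set: T]) \int[mu]_x g i x.
  rewrite esum_mkcond; apply: eq_esum => i _; rewrite /g; case: ifP => //.
  by rewrite integral0.
rewrite esum_series; last by move=> i; exact: integral_ge0.
rewrite (@integral_nneseries _ _ _ mu _ measurableT
  (fun n x => oapp (g ^~ x) 0 (pickle_inv n))) //=.
- by apply: eq_eseriesr => n _; case: pickle_inv => //=; rewrite integral0.
- move=> n; case: pickle_inv => //= i; rewrite /g.
  by case: (boolP (i \in D)) => _; [exact: mf|exact: measurable_cst].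
- by move=> n x _; case: pickle_inv => [i|] //=.
Qed.

Lemma measurable_esum d (Om : measurableType d)
  (T : countType) (D : set T) (f : T -> Om -> \bar R) :
  (forall i, measurable_fun setT (f i)) -> (forall i x, 0 <= f i x) ->
  measurable_fun setT (fun x => \esum_(i in D) f i x).
Proof.
move=> mf f0.
pose g i x := if i \in D then f i x else 0.
have g0 i x : 0 <= g i x by rewrite /g; case: ifP.
have -> : (fun x => \esum_(i in D) f i x) =
    (fun x => \sum_(0 <= n <oo) oapp (g ^~ x) 0 (pickle_inv n)).
  by apply/funext => x; rewrite esum_mkcond (esum_series (fun i => g0 i x)).
apply: (@ge0_emeasurable_sum _ _ _ _ (fun n x => oapp (g ^~ x) 0 (pickle_inv n)) xpredT) => // n.
- by move=> x _ _; case: pickle_inv => [i|] //=.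
- move=> _; case: pickle_inv => //= i; rewrite /g.
  by case: (boolP (i \in D)) => _; [exact: mf|exact: measurable_cst].
Qed.

Lemma rsum_ge0E (S : choiceType) (f : S -> R) : (forall i, (0 <= f i)%R) ->
  rsum f = fine (\esum_(i in [set: S]) (f i)%:E).
Proof.
move=> f0; rewrite /rsum [X in (_ - fine X)%R]esum1 ?subr0; last first.
  move=> i _; rewrite /funrneg; congr EFin; apply/max_idPr.
  by rewrite oppr_le0 f0.
congr fine; apply: eq_esum => i _; rewrite /funrpos; congr EFin.
by apply/max_idPl.
Qed.

Lemma esum_fibers (T K : choiceType) (r : seq K) (k : T -> K)
    (S : set T) (a : T -> \bar R) : uniq r -> (forall l, 0 <= a l) ->
  (forall l, S l -> k l \in r) ->
  \esum_(l in S) a l = \sum_(b <- r) \esum_(l in [set l | S l /\ k l = b]) a l.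
Proof.
move=> ur a0 kr.
transitivity (\sum_(b <- r) \esum_(l in S) (if k l == b then a l else 0)).
  rewrite -esum_sum; last by move=> l b _ _; case: ifP.
  apply: eq_esum => l Sl.
  rewrite (big_rem _ (kr l Sl)) /= eqxx big_seq big1 ?adde0// => b.
  by rewrite mem_rem_uniq// inE => /andP[+ _]; rewrite eq_sym => /negbTE ->.
apply: eq_bigr => b _; rewrite (_ : [set l | _] = S `&` [set l | k l == b]).
  by rewrite esum_mkcondr; apply: eq_esum => l _; rewrite mem_setE.
by apply/seteqP; split => l /= [h /eqP]; split => //; apply/eqP.
Qed.

End esum_toolbox.

(** * Convolution exponentials on the lattice *)

Section convolution_powers.
Context {R : realType} {d : nat}.
Local Notation L := (lattice d).
Local Open Scope ereal_scope.
Implicit Types (q : L -> R) (x y e : L).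

Fixpoint conv_pow q n x : \bar R :=
  if n is m.+1 then \esum_(l in [set: L]) ((q l)%:E * conv_pow q m (x - l)%R)
  else (x == 0%R)%:R%:E.

Lemma conv_pow_ge0 q n x : (forall l, (0 <= q l)%R) -> 0 <= conv_pow q n x.
Proof.
move=> q0; elim: n x => [|n IH] x /=; first by rewrite lee_fin.
by apply: esum_ge0 => l _; rewrite mule_ge0 ?lee_fin.
Qed.

Lemma esum_shift (f : L -> \bar R) x :
  \esum_(l in [set: L]) f (l - x)%R = \esum_(l in [set: L]) f l.
Proof.
rewrite [RHS](@reindex_esumT _ _ _ (fun l : L => l - x)%R)//.
by exists (fun l => l + x)%R => l; rewrite ?subrK ?addrK.
Qed.

Lemma esum_opp (f : L -> \bar R) :
  \esum_(l in [set: L]) f (- l)%R = \esum_(l in [set: L]) f l.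
Proof.
rewrite [RHS](@reindex_esumT _ _ _ (fun l : L => - l)%R)//.
Qed.

Lemma conv_pow_mass q (m : R) n : (forall l, (0 <= q l)%R) ->
  \esum_(l in [set: L]) (q l)%:E = m%:E ->
  \esum_(x in [set: L]) conv_pow q n x = (m ^+ n)%:E.
Proof.
move=> q0 qm; have m0 : (0 <= m)%R.
  by rewrite -lee_fin -qm; apply: esum_ge0 => l _; rewrite lee_fin.
elim: n => [|n IH] /=.
  rewrite (@esum_single _ _ _ 0%R) ?eqxx//.
  by move=> x /negbTE ->.
rewrite exchange_esum; last first.
  by move=> x l; rewrite mule_ge0 ?lee_fin ?conv_pow_ge0.
under eq_esum => l _.
  rewrite esumZl//; last by move=> x; exact: conv_pow_ge0.
  rewrite (esum_shift (fun x => conv_pow q n x)) IH; over.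
rewrite esumZr ?exprn_ge0// ?qm ?exprS//.
Qed.

(** Exponential of [t q] in the convolution algebra of the lattice. The law at
    time [t] of the rate-one walk started at 0 is e^(-t) times the exponential
    of [t (p 0)]. *)
Definition conv_exp q (t : R) x : \bar R :=
  \esum_(n in [set: nat]) ((t ^+ n / n`!%:R)%:E * conv_pow q n x).

Lemma exp_coef_ge0 (t : R) n : (0 <= t)%R -> (0 <= t ^+ n / n`!%:R)%R.
Proof. by move=> t0; rewrite divr_ge0 ?exprn_ge0. Qed.

Lemma conv_exp_ge0 q t x : (forall l, (0 <= q l)%R) -> (0 <= t)%R ->
  0 <= conv_exp q t x.
Proof.
move=> q0 t0; apply: esum_ge0 => n _.
by rewrite mule_ge0 ?conv_pow_ge0// lee_fin exp_coef_ge0.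
Qed.

Lemma esum_expR (t : R) : (0 <= t)%R ->
  \esum_(n in [set: nat]) (t ^+ n / n`!%:R)%:E = (expR t)%:E.
Proof.
move=> t0; rewrite -nneseries_esumT; last first.
  by move=> n; rewrite lee_fin exp_coef_ge0.
rewrite (_ : expR t = limn (series (exp_coeff t)))// -EFin_lim; last first.
  exact: is_cvg_series_exp_coeff.
by congr (limn _); apply/funext => n /=; rewrite -sumEFin.
Qed.

Lemma conv_exp_mass q (m t : R) : (forall l, (0 <= q l)%R) -> (0 <= t)%R ->
  \esum_(l in [set: L]) (q l)%:E = m%:E ->
  \esum_(x in [set: L]) conv_exp q t x = (expR (t * m))%:E.
Proof.
move=> q0 t0 qm; have m0 : (0 <= m)%R.
  by rewrite -lee_fin -qm; apply: esum_ge0 => l _; rewrite lee_fin.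
rewrite /conv_exp exchange_esum; last first.
  by move=> x n; rewrite mule_ge0 ?conv_pow_ge0// lee_fin exp_coef_ge0.
rewrite -esum_expR ?mulr_ge0//; apply: eq_esum => n _.
rewrite esumZl ?exp_coef_ge0//; last by move=> x; exact: conv_pow_ge0.
by rewrite (conv_pow_mass _ q0 qm) -EFinM exprMn mulrAC.
Qed.

End convolution_powers.

Section peeling.
Context {R : realType} {d : nat}.
Local Notation L := (lattice d).
Local Open Scope ereal_scope.
Implicit Types (q : L -> R) (x y e : L).

(** The [n]-th term a_n of [conv_exp], characterised by the recurrence
    (n+1) a_(n+1) = t (q * a_n). Working with this recurrence dispenses with
    binomial coefficients when a product of two exponentials is expanded. *)
Definition exp_term q (t : R) n x : \bar R :=
  (t ^+ n / n`!%:R)%:E * conv_pow q n x.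

Lemma exp_term_ge0 q t n x : (forall l, (0 <= q l)%R) -> (0 <= t)%R ->
  0 <= exp_term q t n x.
Proof. by move=> q0 t0; rewrite mule_ge0 ?lee_fin ?exp_coef_ge0 ?conv_pow_ge0. Qed.

Lemma exp_coefS (t : R) n :
  (n.+1%:R * (t ^+ n.+1 / n.+1`!%:R) = t * (t ^+ n / n`!%:R))%R.
Proof.
rewrite factS natrM invfM exprS.
have n0 : (n.+1%:R : R)%R != 0%R by rewrite pnatr_eq0.
have f0 : (n`!%:R : R)%R != 0%R by rewrite pnatr_eq0 -lt0n fact_gt0.
by field; rewrite f0 addrC natr1 n0.
Qed.

Lemma exp_termS q t n x : (forall l, (0 <= q l)%R) -> (0 <= t)%R ->
  (n.+1%:R)%:E * exp_term q t n.+1 x =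
  t%:E * \esum_(l in [set: L]) (q l)%:E * exp_term q t n (x - l)%R.
Proof.
move=> q0 t0; rewrite /exp_term muleA -EFinM exp_coefS /= EFinM -muleA.
congr (_ * _); rewrite -esumZl ?exp_coef_ge0//; last first.
  by move=> l; rewrite mule_ge0 ?lee_fin ?conv_pow_ge0.
by apply: eq_esum => l _; rewrite !muleA [in LHS](muleC _ (q l)%:E).
Qed.

Definition add_atom (c : R) e q : L -> R := fun l => (q l + c * (l == e)%:R)%R.

Variables (q : L -> R) (c t : R) (e : L).
Hypotheses (q0 : forall l, (0 <= q l)%R) (c0 : (0 <= c)%R) (t0 : (0 <= t)%R).

Let b j m x : \bar R :=
  ((t * c) ^+ j / j`!%:R)%:E * exp_term q t m (x - e *+ j)%R.

Let b_ge0 j m x : 0 <= b j m x.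
Proof. by rewrite mule_ge0 ?exp_term_ge0// lee_fin exp_coef_ge0// mulr_ge0. Qed.

Lemma add_atom_ge0 l : (0 <= add_atom c e q l)%R.
Proof. by rewrite addr_ge0// mulr_ge0. Qed.

Let bSj j m x : (j.+1%:R)%:E * b j.+1 m x = (t * c)%:E * b j m (x - e)%R.
Proof.
rewrite /b muleA -EFinM exp_coefS EFinM -muleA; congr (_ * (_ * exp_term _ _ _ _)).
by rewrite mulrS opprD addrA.
Qed.

Let bSm j m x : (m.+1%:R)%:E * b j m.+1 x =
  t%:E * \esum_(l in [set: L]) (q l)%:E * b j m (x - l)%R.
Proof.
rewrite /b muleCA exp_termS// muleCA; congr (_ * _).
rewrite -esumZl; last 2 first.
- by rewrite exp_coef_ge0// mulr_ge0.
- by move=> l; rewrite mule_ge0 ?lee_fin ?exp_term_ge0.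
apply: eq_esum => l _; rewrite muleCA; congr (_ * (_ * exp_term _ _ _ _)).
by rewrite addrAC.
Qed.

Lemma esum_add_atom (f : L -> \bar R) : (forall x, 0 <= f x) ->
  \esum_(l in [set: L]) ((add_atom c e q l)%:E * f l) =
  \esum_(l in [set: L]) ((q l)%:E * f l) + c%:E * f e.
Proof.
move=> f0; under eq_esum => l _.
  rewrite EFinD ge0_muleDl ?lee_fin// ?mulr_ge0//; over.
rewrite esumD//; last 2 first.
- by move=> l _; rewrite mule_ge0 ?lee_fin.
- by move=> l _; rewrite mule_ge0 ?lee_fin// mulr_ge0.
congr (_ + _); rewrite (@esum_single _ _ _ e) ?eqxx ?mulr1//.
- by rewrite mule_ge0 ?lee_fin.
- by move=> l /negbTE ->; rewrite mulr0 mul0e.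
Qed.

(** Both sides obey the recurrence of [exp_termS]: in the sum the factor n+1 is
    split as j + (n+1-j), the first part acting on the jumps along [e] and the
    second one on those of [q]. *)
Lemma exp_term_add_atom n x :
  exp_term (add_atom c e q) t n x = \sum_(j < n.+1) b j (n - j)%N x.
Proof.
elim: n x => [|n IH] x.
  rewrite big_ord1 /b /exp_term /= subn0 mulr0n subr0 !expr0 fact0 invr1 mulr1.
  by rewrite !mul1e.
suff H : n.+1%:R%:E * exp_term (add_atom c e q) t n.+1 x =
    n.+1%:R%:E * \sum_(j < n.+2) b j (n.+1 - j)%N x.
  have k1 : 1 = (n.+1%:R^-1 : R)%:E * (n.+1%:R)%:E :> \bar R.
    by rewrite -EFinM mulVf// pnatr_eq0.
  by rewrite -[LHS]mul1e -[RHS]mul1e k1 -!muleA H.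
rewrite exp_termS//; last exact: add_atom_ge0.
rewrite (esum_add_atom (f := fun l => exp_term (add_atom c e q) t n (x - l)%R)); last first.
  by move=> l; apply: exp_term_ge0 => //; exact: add_atom_ge0.
rewrite ge0_muleDr; last 2 first.
- by apply: esum_ge0 => l _; rewrite mule_ge0 ?lee_fin ?exp_term_ge0// => k; exact: add_atom_ge0.
- by rewrite mule_ge0 ?lee_fin ?exp_term_ge0// => k; exact: add_atom_ge0.
rewrite ge0_sume_distrr; last by [].
have split_j (j : 'I_n.+2) : n.+1%:R%:E * b j (n.+1 - j)%N x =
    ((n.+1 - j)%N%:R)%:E * b j (n.+1 - j)%N x + (j%:R)%:E * b j (n.+1 - j)%N x.
  by rewrite -ge0_muleDl ?lee_fin// -EFinD -natrD subnK// -ltnS.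
rewrite (eq_bigr _ (fun j _ => split_j j)) big_split /=; congr (_ + _).
- rewrite big_ord_recr /= subnn mul0e adde0.
  rewrite (eq_bigr (fun j : 'I_n.+1 => t%:E *
    \esum_(l in [set: L]) (q l)%:E * b j (n - j)%N (x - l)%R)); last first.
    by move=> j _; rewrite subSn ?bSm// -ltnS.
  rewrite -ge0_sume_distrr; last first.
    by move=> j _; apply: esum_ge0 => l _; rewrite mule_ge0 ?lee_fin.
  rewrite -esum_sum; last by move=> l j _ _; rewrite mule_ge0 ?lee_fin.
  congr (_ * _); apply: eq_esum => l _; rewrite IH ge0_sume_distrr//.
- rewrite big_ord_recl /= mul0e add0e muleA -EFinM IH ge0_sume_distrr//.
  by apply: eq_bigr => j _; rewrite /bump /= add1n subSS bSj.
Qed.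

(** Convolution is commutative, so the exponential of a sum is the product of
    the exponentials: the jumps along [e] are counted by a Poisson variable
    independent of all the other jumps. *)
Lemma conv_exp_add_atom x :
  conv_exp (add_atom c e q) t x =
  \esum_(j in [set: nat])
    ((t * c) ^+ j / j`!%:R)%:E * conv_exp q t (x - e *+ j)%R.
Proof.
transitivity (\esum_(n in [set: nat]) \esum_(j in [set: nat])
    (if (j <= n)%N then b j (n - j)%N x else 0)).
  apply: eq_esum => n _; rewrite -/(exp_term _ _ _ _) exp_term_add_atom.
  rewrite -nneseries_esumT; last by move=> j; case: ifP.
  rewrite (nneseries_split 0 n.+1); last by move=> k _; case: ifP.
  rewrite add0n [X in _ + X]eseries0 ?adde0; last first.
    by move=> k nk _ /=; rewrite leqNgt nk.
  rewrite big_mkord; apply: eq_bigr => j _; by rewrite -ltnS ltn_ord.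
rewrite exchange_esum; last by move=> n j; case: ifP.
apply: eq_esum => j _.
rewrite (_ : \esum_(n in _) _ = \esum_(n in [set n | (j <= n)%N]) b j (n - j)%N x); last first.
  by rewrite [RHS]esum_mkcond; apply: eq_esum => n _; rewrite mem_setE.
rewrite (@reindex_esum _ _ _ [set: nat] _ (fun m => m + j)%N).
- rewrite /conv_exp -esumZl; last 2 first.
  + by rewrite exp_coef_ge0// mulr_ge0.
  + by move=> m; exact: exp_term_ge0.
  by apply: eq_esum => m _; rewrite /b addnK.
split=> //=.
- by move=> m _ /=; rewrite leq_addl.
- by move=> m1 m2 _ _; exact: addIn.
- by move=> n /= jn; exists (n - j)%N => //; rewrite subnK.
Qed.
End peeling.

(** * Local bound for the transition probabilities *)

Section poisson_sup.
Context {R : realType}.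

(** Each of the ratios of consecutive coefficients met between the ranks [n] and
    [n + i] is at least s / (s + m). *)
Lemma exp_coef_window (s : R) (n i m : nat) : 0 < s -> n%:R <= s -> (i <= m)%N ->
  s ^+ n / n`!%:R * (s / (s + m%:R)) ^+ i <= s ^+ (n + i) / (n + i)`!%:R.
Proof.
move=> s0 ns; elim: i => [|i IH] im; first by rewrite expr0 mulr1 addn0.
have sm0 : 0 < s + m%:R by rewrite ltr_wpDr.
rewrite exprSr mulrA addnS.
have -> : s ^+ (n + i).+1 / (n + i).+1`!%:R
    = s ^+ (n + i) / (n + i)`!%:R * (s / (n + i).+1%:R).
  by rewrite factS natrM invfM exprSr; ring.
apply: ler_pM => //.
- by rewrite mulr_ge0 ?exprn_ge0 ?divr_ge0 ?exprn_ge0 ?(ltW sm0) ?(ltW s0).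
- by rewrite divr_ge0 ?(ltW s0) ?(ltW sm0).
- by apply: IH; exact: ltnW.
- rewrite ler_pM2l// lef_pV2 ?posrE// -addnS natrD lerD//.
  by rewrite ler_nat.
Qed.

(** The coefficients whose rank exceeds [n] by at most sqrt s are all comparable
    with the [n]-th one, since (s / (s + m))^m is at least 1/e for m <= sqrt s.
    There are more than sqrt s of them, and they add up to at most e^s. *)
Lemma exp_coef_le_sqrt_below (s : R) (n : nat) : 0 < s -> n%:R <= s ->
  s ^+ n / n`!%:R <= expR 1 * expR s / Num.sqrt s.
Proof.
move=> s0 ns; have q0 : 0 < Num.sqrt s by rewrite sqrtr_gt0.
set m := Num.trunc (Num.sqrt s).
have /andP[ms sm] := truncn_itv (ltW q0); rewrite -/m in ms sm.
have sm0 : 0 < s + m%:R by rewrite ltr_wpDr.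
set a := s ^+ n / n`!%:R; have a0 : 0 <= a by rewrite exp_coef_ge0// ltW.
set r := s / (s + m%:R).
have r0 : 0 <= r by rewrite divr_ge0// ltW.
have r1 : r <= 1 by rewrite ler_pdivrMr// mul1r lerDl.
have rm : expR (- 1) <= r ^+ m.
  have -> : r ^+ m = ((1 + m%:R / s) ^+ m)^-1.
    rewrite -exprVn /r -[1](@mulfV _ s) ?gt_eqF// -mulrDl invfM invrK mulrC.
    by [].
  rewrite expRN lef_pV2 ?posrE ?expR_gt0 ?exprn_gt0 ?ltr_wpDr// ?divr_ge0 ?(ltW s0)//.
  apply: (@le_trans _ _ (expR (m%:R / s) ^+ m)).
    by rewrite lerXn2r ?nnegrE ?expR_ge0 ?expR_ge1Dx// addr_ge0// divr_ge0 ?(ltW s0).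
  rewrite -expRM_natl ler_expR mulrA ler_pdivrMr// mul1r -expr2.
  by rewrite -[leRHS](@sqr_sqrtr _ s) ?(ltW s0)// lerXn2r ?nnegrE ?(ltW q0).
have sum_le : \sum_(i < m.+1) (a * expR (- 1)) <= expR s.
  apply: (@le_trans _ _ (\sum_(i < m.+1) (s ^+ (n + i) / (n + i)`!%:R))).
    apply: ler_sum => i _; have im : (i <= m)%N by rewrite -ltnS.
    apply: le_trans (exp_coef_window s0 ns im); rewrite ler_wpM2l//.
    by rewrite (le_trans rm)// -/r ler_wiXn2l.
  rewrite -lee_fin -(esum_expR (ltW s0)) -sumEFin.
  rewrite -(big_mkord xpredT (fun i => (s ^+ (n + i) / (n + i)`!%:R)%:E)).
  rewrite -(big_map (addn n) xpredT (fun i => (s ^+ i / i`!%:R)%:E)).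
  apply: le_seq_esum => //; rewrite map_inj_uniq ?iota_uniq//; exact: addnI.
rewrite ler_pdivlMr//.
rewrite sumr_const card_ord -mulr_natl in sum_le.
have : a * expR (-1) * Num.sqrt s <= expR s.
  by apply: le_trans sum_le; rewrite mulrC ler_wpM2r ?(mulr_ge0 a0 (expR_ge0 _)) ?(ltW sm).
rewrite mulrAC expRN ler_pdivrMr ?expR_gt0// => h.
by rewrite [leRHS]mulrC.
Qed.

(** A Poisson variable of parameter [s] gives no point more than O(s^(-1/2)).
    Past [s] the coefficients decrease, which reduces to the ranks below [s]. *)
Lemma exp_coef_le_sqrt (s : R) (n : nat) : 0 < s ->
  s ^+ n / n`!%:R <= expR 1 * expR s / Num.sqrt s.
Proof.
move=> s0; have q0 : 0 < Num.sqrt s by rewrite sqrtr_gt0.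
elim: n => [|n IH].
  by apply: exp_coef_le_sqrt_below => //; exact: ltW.
have [ns|sn] := leP n.+1%:R s; first exact: exp_coef_le_sqrt_below.
apply: le_trans IH.
have -> : s ^+ n.+1 / n.+1`!%:R = s ^+ n / n`!%:R * (s / n.+1%:R).
  by rewrite factS natrM invfM exprSr; ring.
rewrite ler_piMr ?exp_coef_ge0 ?(ltW s0)//.
by rewrite ler_pdivrMr ?ltr0n// mul1r ltW.
Qed.
End poisson_sup.

Section atoms.
Context {R : realType} {d : nat}.
Local Notation L := (lattice d).
Local Open Scope ereal_scope.
Implicit Types (q : L -> R) (x y e : L).

Definition add_atoms q (s : seq (L * R)) : L -> R :=
  foldr (fun a => add_atom a.2 a.1) q s.

Lemma add_atoms_ge0 q s : (forall l, (0 <= q l)%R) ->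
  (forall a, a \in s -> (0 <= a.2)%R) -> forall l, (0 <= add_atoms q s l)%R.
Proof.
move=> q0; elim: s => [//|a s IH] h l /=; apply: add_atom_ge0; last exact/h/mem_head.
by apply: IH => b bs; apply: h; rewrite inE bs orbT.
Qed.

Definition lin_comb (s : seq L) (js : seq nat) : L :=
  (\sum_(a <- zip s js) a.1 *+ a.2)%R.

(** Once the jumps along the vectors of [s] are singled out, the Poisson weight of
    each of their numbers is replaced by its supremum, and what is left is a sum
    over all the possible numbers of jumps. *)
Lemma conv_exp_add_atoms_le q s (t : R) x : (0 < t)%R ->
  (forall l, (0 <= q l)%R) -> (forall a, a \in s -> (0 < a.2)%R) ->
  conv_exp (add_atoms q s) t x <=
  (\prod_(a <- s) (expR 1 * expR (t * a.2) / Num.sqrt (t * a.2)))%:E *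
  \esum_(js in [set js : seq nat | size js = size s])
     conv_exp q t (x - lin_comb (map fst s) js)%R.
Proof.
move=> t0 q0; elim: s x => [|[e c] s IH] x sp.
  rewrite big_nil mul1e; apply: le_trans (le_term_esum _ (i := [::]) _) => //.
  by rewrite /lin_comb /= big_nil subr0.
have c0 : (0 < c)%R by exact: (sp (e, c) (mem_head _ _)).
have sp' a : a \in s -> (0 < a.2)%R by move=> h; apply: sp; rewrite inE h orbT.
have qs0 := add_atoms_ge0 q0 (fun a ha => ltW (sp' a ha)).
rewrite /= conv_exp_add_atom ?(ltW c0) ?(ltW t0)// big_cons EFinM -muleA /=.
set B := (_ / _)%R; set P := (\prod_(_ <- _) _)%R.
have B0 : (0 <= B)%R by rewrite mulr_ge0 ?invr_ge0 ?sqrtr_ge0// mulr_ge0 ?expR_ge0.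
have P0 : (0 <= P)%R.
  by apply: prodr_ge0 => a _; rewrite mulr_ge0 ?invr_ge0 ?sqrtr_ge0// mulr_ge0 ?expR_ge0.
have G0 y : 0 <= conv_exp q t y by exact: conv_exp_ge0 (ltW t0).
apply: (@le_trans _ _ (\esum_(j in [set: nat]) B%:E * (P%:E *
   \esum_(js in [set js | size js = size s])
    conv_exp q t (x - e *+ j - lin_comb [seq i.1 | i <- s] js)%R))).
  apply: le_esum => j _; apply: lee_pmul.
  - by rewrite lee_fin exp_coef_ge0// mulr_ge0// ltW.
  - exact: conv_exp_ge0 (ltW t0).
  - by rewrite lee_fin exp_coef_le_sqrt// mulr_gt0.
  - exact: IH.
rewrite esumZl// ?lee_wpmul2l ?lee_fin//; last first.
  by move=> j; rewrite mule_ge0// ?esum_ge0.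
rewrite esumZl//; last by move=> j; rewrite esum_ge0.
rewrite lee_wpmul2l ?lee_fin// esum_esum//.
rewrite (@reindex_esum _ _ _ ([set: nat] `*`` (fun=> [set js : seq nat | size js = size s]))
  [set js : seq nat | size js = (size s).+1] (fun k => k.1 :: k.2)).
  apply: le_esum => -[j js] _ /=.
  by rewrite /lin_comb /= big_cons opprD addrA.
split=> //=.
- by move=> [j js] /= [_ ->].
- by move=> [j js] [j' js'] _ _ /= [-> ->].
- by move=> [//|j js] /= [h]; exists (j, js).
Qed.

(** When distinct numbers of jumps lead to distinct points, the sum runs over
    part of the lattice and is controlled by the total mass. *)
Lemma lin_comb_inj_le q s (t : R) x (m : R) : (0 <= t)%R -> (forall l, (0 <= q l)%R) ->
  \esum_(l in [set: L]) (q l)%:E = m%:E ->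
  (forall js js', size js = size s -> size js' = size s ->
     lin_comb s js = lin_comb s js' -> js = js') ->
  \esum_(js in [set js : seq nat | size js = size s])
     conv_exp q t (x - lin_comb s js)%R <= (expR (t * m))%:E.
Proof.
move=> t0 q0 qm inj; rewrite -(conv_exp_mass q0 t0 qm).
rewrite -(@esum_image _ _ _ _ (fun js => x - lin_comb s js)%R).
  exact: le_esum_sub.
by move=> js js'; rewrite !inE /= => h h' /addrI /oppr_inj; exact: inj.
Qed.

Lemma add_atoms_mass q s (m : R) : (forall l, (0 <= q l)%R) ->
  (forall a, a \in s -> (0 <= a.2)%R) ->
  \esum_(l in [set: L]) (q l)%:E = m%:E ->
  \esum_(l in [set: L]) (add_atoms q s l)%:E = (m + \sum_(a <- s) a.2)%:E.
Proof.
move=> q0 + qm; elim: s => [|[e c] s IH] sp /=; first by rewrite big_nil addr0.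
have sp' a : a \in s -> (0 <= a.2)%R by move=> h; apply: sp; rewrite inE h orbT.
have c0 : (0 <= c)%R by exact: (sp (e, c) (mem_head _ _)).
under eq_esum do rewrite -[_%:E]mule1.
rewrite esum_add_atom//; last exact: add_atoms_ge0.
under eq_esum do rewrite mule1.
by rewrite IH// mule1 -EFinD big_cons /= addrAC addrA.
Qed.

(** The masses cancel: what the remaining jumps contribute, times the
    exponential factors of the atoms, is exactly e^t. Each vector of [s] is left
    with a factor O(t^(-1/2)). *)
Lemma conv_exp_le q (s : seq L) (t : R) x : (0 < t)%R ->
  (forall l, (0 <= q l)%R) -> \esum_(l in [set: L]) (q l)%:E = 1 ->
  uniq s -> (forall e, e \in s -> (0 < q e)%R) ->
  (forall js js', size js = size s -> size js' = size s ->
     lin_comb s js = lin_comb s js' -> js = js') ->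
  (expR (- t))%:E * conv_exp q t x <=
  (\prod_(e <- s) (expR 1 / Num.sqrt (q e)) * (Num.sqrt t) ^- size s)%:E.
Proof.
move=> t0 q0 q1 us sp inj.
pose r l := if l \in s then 0%R else q l.
have r0 l : (0 <= r l)%R by rewrite /r; case: ifP.
pose a := [seq (e, q e) | e <- s].
have qE : q = add_atoms r a.
  apply/funext => l; rewrite /r /a.
  have gen (g : L -> R) s' : uniq s' -> add_atoms g [seq (e, q e) | e <- s'] l =
      (g l + (if l \in s' then q l else 0))%R.
    elim: s' => [|e s' IH] /=; first by rewrite addr0.
    move=> /andP[es us']; rewrite /add_atom /= IH// inE -addrA; congr +%R.
    have [->|le] /= := eqVneq l e; first by rewrite (negbTE es) add0r mulr1.
    by rewrite mulr0 addr0.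
  by rewrite gen//; case: ifP; rewrite ?add0r ?addr0.
have rfin : exists m, \esum_(l in [set: L]) (r l)%:E = m%:E.
  have le1 : \esum_(l in [set: L]) (r l)%:E <= 1.
    by rewrite -q1; apply: le_esum => l _; rewrite lee_fin /r; case: ifP.
  exists (fine (\esum_(l in [set: L]) (r l)%:E)); rewrite fineK//.
  rewrite ge0_fin_numE ?(le_lt_trans le1) ?ltry//.
  by apply: esum_ge0 => l _; rewrite lee_fin.
have [m rm] := rfin.
have ap b : b \in a -> (0 < b.2)%R by move=> /mapP[e es ->] /=; exact: sp.
have mc : (m + \sum_(e <- s) q e)%R = 1%R.
  have := add_atoms_mass r0 (fun b hb => ltW (ap b hb)) rm.
  by rewrite -qE q1 big_map => -[].
have map1 : map fst a = s by rewrite -map_comp map_id.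
have size1 : size a = size s by rewrite size_map.
have inj' := inj; rewrite -map1 in inj'.
have := @lin_comb_inj_le r (map fst a) t x m (ltW t0) r0 rm inj'.
rewrite (size_map fst a) => L1.
have L2 := @conv_exp_add_atoms_le r a t x t0 r0 ap.
rewrite -qE in L2.
apply: (@le_trans _ _ ((expR (- t))%:E *
  ((\prod_(b <- a) (expR 1 * expR (t * b.2) / Num.sqrt (t * b.2)))%:E * (expR (t * m))%:E))).
  rewrite lee_wpmul2l ?lee_fin ?expR_ge0//; apply: le_trans L2 _.
  rewrite lee_wpmul2l// lee_fin; apply: prodr_ge0 => b _.
  by rewrite mulr_ge0 ?invr_ge0 ?sqrtr_ge0// mulr_ge0 ?expR_ge0.
rewrite -!EFinM lee_fin big_map /=.
rewrite (eq_bigr (fun e => expR (t * q e) * (expR 1 / Num.sqrt (q e) * (Num.sqrt t)^-1)))%R; last first.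
  by move=> e _; rewrite sqrtrM ?(ltW t0)// invfM; ring.
rewrite big_split /= -expR_sum big_split /= -mulr_sumr.
rewrite mulrCA -!mulrA mulrC.
rewrite big_const_seq iter_mulr mulr1 count_predT exprVn.
rewrite [leLHS](_ : _ = (\prod_(e <- s) (expR 1 / Num.sqrt (q e)) * Num.sqrt t ^- size s) *
  (expR (t * \sum_(e <- s) q e) * expR (- t) * expR (t * m)))%R; last by ring.
rewrite -!expRD (_ : t * _ - t + t * m = 0)%R ?expR0 ?mulr1//.
by rewrite (_ : m = 1 - \sum_(e <- s) q e)%R; [ring|rewrite -mc addrK].
Qed.

End atoms.

Section heat_kernel_facts.
Context {R : realType} {d : nat} (p : lattice d -> lattice d -> R).
Hypothesis hp : jump_kernel p.
Local Notation L := (lattice d).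
Local Open Scope ereal_scope.
Implicit Types (x y e : L).

Let p0_ge0 l : (0 <= p 0%R l)%R. Proof. exact: jk_ge0 hp _ _. Qed.

Let p0_mass : \esum_(l in [set: L]) (p 0%R l)%:E = 1. Proof. exact: jk_sum1 hp _. Qed.

Lemma conv_pow_fin n x : conv_pow (p 0%R) n x \is a fin_num.
Proof.
rewrite ge0_fin_numE; last exact: conv_pow_ge0.
apply: le_lt_trans (le_term_esum _ (D := setT) _) _ => //.
by rewrite (conv_pow_mass n p0_ge0 p0_mass) ltry.
Qed.

Lemma nstep_conv_pow n i j : (nstep p n i j)%:E = conv_pow (p 0%R) n (j - i)%R.
Proof.
elim: n i => [|n IH] i /=; first by rewrite subr_eq0 eq_sym.
have nstep_ge0 k : (0 <= nstep p n k j)%R by rewrite -lee_fin IH conv_pow_ge0.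
rewrite rsum_ge0E; last by move=> l; rewrite mulr_ge0// (jk_ge0 hp).
have E : \esum_(l in [set: L]) (p i l * nstep p n l j)%:E = conv_pow (p 0%R) n.+1 (j - i)%R.
  rewrite /= -(esum_shift (fun l => (p 0%R l)%:E * conv_pow (p 0%R) n (j - i - l)%R) i).
  apply: eq_esum => l _ /=; rewrite EFinM IH (jk_transl hp i l); congr (_ * conv_pow _ _ _).
  by rewrite opprB addrA subrK.
by rewrite fineK E// conv_pow_fin.
Qed.

Lemma conv_exp_fin t x : (0 <= t)%R -> conv_exp (p 0%R) t x \is a fin_num.
Proof.
move=> t0; rewrite ge0_fin_numE; last exact: conv_exp_ge0.
apply: le_lt_trans (le_term_esum _ (D := setT) _) _ => //.
by rewrite (conv_exp_mass p0_ge0 t0 p0_mass) ltry.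
Qed.

Lemma heat_kernelE t i j : (0 <= t)%R ->
  (heat_kernel p t i j)%:E = (expR (- t))%:E * conv_exp (p 0%R) t (j - i)%R.
Proof.
move=> t0; have nstep_ge0 n : (0 <= nstep p n i j)%R by rewrite -lee_fin nstep_conv_pow conv_pow_ge0.
rewrite /heat_kernel rsum_ge0E; last first.
  by move=> n; rewrite !mulr_ge0 ?expR_ge0 ?exprn_ge0 ?invr_ge0.
have E : \esum_(n in [set: nat]) (expR (- t) * t ^+ n / n`!%:R * nstep p n i j)%:E =
    (expR (- t))%:E * conv_exp (p 0%R) t (j - i)%R.
  rewrite -esumZl ?expR_ge0//; last first.
    by move=> n; rewrite mule_ge0 ?lee_fin ?exp_coef_ge0 ?conv_pow_ge0.
  by apply: eq_esum => n _; rewrite -nstep_conv_pow -!EFinM !mulrA.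
by rewrite fineK E// fin_numM ?conv_exp_fin.
Qed.

Lemma heat_kernel_ge0 t i j : (0 <= t)%R -> (0 <= heat_kernel p t i j)%R.
Proof.
move=> t0; rewrite -lee_fin heat_kernelE// mule_ge0 ?lee_fin ?expR_ge0//.
exact: conv_exp_ge0.
Qed.

Lemma heat_kernel_row t i : (0 <= t)%R ->
  \esum_(j in [set: L]) (heat_kernel p t i j)%:E = 1.
Proof.
move=> t0; under eq_esum do rewrite heat_kernelE//.
rewrite esumZl ?expR_ge0//; last by move=> l; exact: conv_exp_ge0.
rewrite (esum_shift (conv_exp (p 0%R) t)) (conv_exp_mass p0_ge0 t0 p0_mass).
by rewrite -EFinM mulr1 -expRD addNr expR0.
Qed.

(** Symmetry and translation invariance make the jump law even. *)
Lemma conv_pow_opp n x : conv_pow (p 0%R) n (- x)%R = conv_pow (p 0%R) n x.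
Proof.
elim: n x => [|n IH] x /=; first by rewrite oppr_eq0.
rewrite -(esum_opp (fun l => (p 0%R l)%:E * conv_pow (p 0%R) n (x - l)%R)).
apply: eq_esum => l _; rewrite -opprD IH opprK; congr ((_)%:E * _).
by rewrite (jk_sym hp) (jk_transl hp) sub0r.
Qed.

Lemma heat_kernel_sym t i j : (0 <= t)%R -> heat_kernel p t i j = heat_kernel p t j i.
Proof.
move=> t0; apply: EFin_inj; rewrite !heat_kernelE//; congr (_ * _).
by apply: eq_esum => n _; rewrite -[in RHS]conv_pow_opp opprB.
Qed.

Lemma heat_kernel_col t j : (0 <= t)%R ->
  \esum_(i in [set: L]) (heat_kernel p t i j)%:E = 1.
Proof.
by move=> t0; under eq_esum do rewrite heat_kernel_sym//; exact: heat_kernel_row.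
Qed.

Lemma heat_kernel_le1 t i j : (0 <= t)%R -> (heat_kernel p t i j <= 1)%R.
Proof.
move=> t0; rewrite -lee_fin -(heat_kernel_row i t0).
exact: (le_term_esum (fun j => (heat_kernel p t i j)%:E)).
Qed.

Lemma conv_pow_gt0_steps n x : 0 < conv_pow (p 0%R) n x ->
  exists2 s : seq L, (forall e, e \in s -> (0 < p 0%R e)%R) & x = (\sum_(e <- s) e)%R.
Proof.
elim: n x => [|n IH] x /=.
  have [->|_] := eqVneq x 0%R; last by rewrite ltxx.
  by exists [::] => //; rewrite big_nil.
move=> h; have [l hl] : exists l, (p 0%R l)%:E * conv_pow (p 0%R) n (x - l)%R != 0.
  apply: contrapT => /forallNP hl; move: h; rewrite esum1 ?ltxx// => l _.
  by have /negP := hl l; rewrite negbK => /eqP.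
have pl : (p 0%R l != 0)%R by apply: contraNneq hl => ->; rewrite mul0e.
have [|s sp xl] := IH (x - l)%R.
  rewrite lt_neqAle conv_pow_ge0// andbT eq_sym.
  by apply: contraNneq hl => ->; rewrite mule0.
exists (l :: s); last by rewrite big_cons -xl addrCA subrr addr0.
move=> e; rewrite inE => /orP[/eqP->|/sp//].
by rewrite lt_neqAle eq_sym pl p0_ge0.
Qed.

End heat_kernel_facts.

Section independent_steps.
Context {d : nat}.
Local Notation L := (lattice d).

Definition ratv (x : L) : 'rV[rat]_d := map_mx intr x.

Lemma ratv_lin_comb (s : seq L) js :
  ratv (lin_comb s js) = \sum_(a <- zip s js) ratv a.1 *+ a.2.
Proof.
rewrite /lin_comb; elim: (zip s js) => [|a t IH].
  by rewrite !big_nil; apply/matrixP => i j; rewrite !mxE.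
rewrite !big_cons -IH; apply/matrixP => i j; rewrite !mxE rmorphD !mulmxnE !mxE.
by rewrite rmorphMn.
Qed.

(** The rational row space of the vectors occurring in the given sums contains
    the unit vectors, hence is everything, so that [d] of these vectors form an
    invertible matrix. Numbers of jumps are then recovered from the total
    displacement by inverting it. *)
Lemma independent_steps (A : L -> Prop) :
  (forall i : 'I_d, exists2 s : seq L, (forall e, e \in s -> A e) &
     delta_mx 0 i = \sum_(e <- s) e) ->
  exists s : seq L, [/\ size s = d, uniq s, (forall e, e \in s -> A e) &
   forall js js', size js = size s -> size js' = size s ->
     lin_comb s js = lin_comb s js' -> js = js'].
Proof.
move=> h.
have /choice[g gP] : forall i : 'I_d, exists s : seq L,
    (forall e, e \in s -> A e) /\ delta_mx 0 i = \sum_(e <- s) e.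
  by move=> i; have [s s1 s2] := h i; exists s.
pose S := flatten [seq g i | i <- enum 'I_d].
have SA e : e \in S -> A e.
  by move=> /flattenP[_ /mapP[i _ ->]]; exact: (gP i).1.
pose M : 'M[rat]_(size S, d) := \matrix_k ratv (nth 0 S k).
have Mrow e : e \in S -> (ratv e <= M)%MS.
  move=> eS; have eS' : (index e S < size S)%N by rewrite index_mem.
  have := row_sub (Ordinal eS') M; rewrite rowK /= nth_index//.
have Mfull : row_full M.
  rewrite -sub1mx; apply/row_subP => i; rewrite row1.
  have -> : delta_mx 0 i = \sum_(e <- g i) ratv e :> 'rV[rat]_d.
    have <- : ratv (delta_mx 0 i) = delta_mx 0 i.
      by apply/matrixP => a b; rewrite !mxE; case: (_ && _).
    rewrite (gP i).2; elim: (g i) => [|a t IH].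
      by rewrite !big_nil; apply/matrixP => a b; rewrite !mxE.
    by rewrite !big_cons -IH; apply/matrixP => a' b; rewrite !mxE rmorphD.
  rewrite big_seq; apply: summx_sub => e eg; apply: Mrow.
  by apply/flattenP; exists (g i) => //; apply: map_f; rewrite mem_enum.
pose f := fullrankfun Mfull; pose B := rowsub f M.
have Bfree : row_free B by exact: fullrowsub_free.
pose s := [seq nth 0 S (f i) | i <- enum 'I_d].
have ss : size s = d by rewrite size_map size_enum_ord.
have s_nth (i : 'I_d) : nth 0 s i = nth 0 S (f i).
  by rewrite (nth_map i) ?size_enum_ord// nth_ord_enum.
have Brow (i : 'I_d) : row i B = ratv (nth 0 s i).
  by rewrite /B row_rowsub rowK s_nth.
have comb js : size js = d ->
    ratv (lin_comb s js) = (\row_(i < d) (nth 0%N js i)%:R) *m B.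
  move=> sj; rewrite ratv_lin_comb mulmx_sum_row (big_nth (0, 0%N)) size_zip ss sj minnn.
  rewrite big_mkord; apply: eq_bigr => i _.
  by rewrite mxE Brow nth_zip ?sj// scaler_nat.
exists s; split => //.
- rewrite map_inj_in_uniq ?enum_uniq// => i j _ _ eqij.
  have : (delta_mx 0 i : 'rV[rat]_d) *m B = (delta_mx 0 j : 'rV[rat]_d) *m B.
    by rewrite -!rowE !Brow !s_nth eqij.
  move=> /(row_free_inj Bfree) /matrixP /(_ 0 i); rewrite !mxE !eqxx /=.
  by case: eqVneq => // _ /eqP; rewrite oner_eq0.
- move=> e /mapP[i _ ->]; apply: SA; exact: mem_nth.
- move=> js js'; rewrite ss => sj sj' /(congr1 ratv); rewrite !comb//.
  move=> /(row_free_inj Bfree) /matrixP E; apply: (@eq_from_nth _ 0%N); rewrite ?sj ?sj'//.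
  move=> i id; have := E 0 (Ordinal id); rewrite !mxE /= => /eqP.
  by rewrite eqr_nat => /eqP.
Qed.

End independent_steps.

(** Upper half of the local limit theorem. By irreducibility every unit vector
    is a sum of allowed jumps, so there are [d] linearly independent ones, each
    of which brings a factor O(t^(-1/2)). *)
Lemma heat_kernel_bound (R : realType) (d : nat) (p : lattice d -> lattice d -> R) :
  jump_kernel p -> exists2 K : R, 0 <= K & forall (t : R) i j, 0 < t ->
    heat_kernel p t i j <= K * Num.sqrt t ^- d.
Proof.
move=> hp.
have [i|s [sd us sp inj]] := @independent_steps d (fun e => 0 < p 0 e).
  have [n hn] := jk_irr hp 0 (delta_mx 0 i).
  apply: (conv_pow_gt0_steps hp (n := n)).
  by rewrite -[X in conv_pow _ _ X]subr0 -(nstep_conv_pow hp) lte_fin.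
exists (\prod_(e <- s) (expR 1 / Num.sqrt (p 0 e))).
  by apply: prodr_ge0 => e _; rewrite divr_ge0 ?expR_ge0 ?sqrtr_ge0.
move=> t i j t0; rewrite -lee_fin (heat_kernelE hp)// ?(ltW t0)//.
rewrite -[X in _ ^- X]sd; apply: conv_exp_le => //; first exact: jk_ge0 hp _.
exact: jk_sum1 hp _.
Qed.

(** * Lattice sums of Schwartz functions *)

Section schwartz_sum.
Context {R : realType}.

(** The sum telescopes, because
    1 / (1 + (m / N)^2) <= 2 N^2 (1 / (N + m - 1) - 1 / (N + m)) for m > 0. *)
Lemma cauchy_weight_sum (N : R) n : 1 <= N ->
  \sum_(m < n.+1) (1 + (N^-1 * m%:R) ^+ 2)^-1 <= 1 + 2 * N - 2 * N ^+ 2 / (N + n%:R).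
Proof.
move=> N1; have N0 : 0 < N by exact: lt_le_trans ltr01 N1.
elim: n => [|n IH].
  rewrite big_ord1 mulr0 expr0n addr0 invr1 addr0 expr2 mulrA mulfK ?gt_eqF//.
  by lra.
rewrite big_ord_recr /=; apply: le_trans (lerD IH (lexx _)) _.
set m : R := n%:R; have m0 : 0 <= m by rewrite /m.
have -> : n.+1%:R = m + 1 :> R by rewrite natr1.
have Nm : 0 < N + m by rewrite ltr_wpDr.
have Nm1 : 0 < N + (m + 1) by rewrite ltr_wpDr// addr_ge0.
have -> : (1 + (N^-1 * (m + 1)) ^+ 2)^-1 = N ^+ 2 / (N ^+ 2 + (m + 1) ^+ 2).
  have : N ^+ 2 + (m + 1) ^+ 2 != 0.
    by rewrite gt_eqF// ltr_pwDl ?exprn_gt0// exprn_ge0// addr_ge0.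
  move=> D0; field; rewrite D0 gt_eqF//.
rewrite -lerBrDl.
have -> : 1 + 2 * N - 2 * N ^+ 2 / (N + (m + 1)) - (1 + 2 * N - 2 * N ^+ 2 / (N + m))
    = N ^+ 2 * (2 / ((N + m) * (N + (m + 1)))).
  by field; rewrite !gt_eqF.
rewrite ler_wpM2l ?exprn_ge0 ?(ltW N0)//.
have D0 : 0 < N ^+ 2 + (m + 1) ^+ 2.
  by rewrite ltr_pwDl ?exprn_gt0// exprn_ge0// addr_ge0.
have E0 : 0 < (N + m) * (N + (m + 1)) / 2 by rewrite divr_gt0 ?mulr_gt0.
rewrite -[leRHS]invf_div lef_pV2 ?posrE// ler_pdivrMr//.
have : 0 <= (N - (m + 1)) ^+ 2 by exact: sqr_ge0.
nra.
Qed.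

Lemma cauchy_weight_sumZ (N : R) (B : nat) : 1 <= N ->
  \sum_(k < (2 * B).+1) (1 + (N^-1 * (k%:Z - B%:Z)%:~R) ^+ 2)^-1 <= 6 * N.
Proof.
move=> N1; have N0 : 0 < N by exact: lt_le_trans ltr01 N1.
have le3 n : \sum_(m < n) (1 + (N^-1 * m%:R) ^+ 2)^-1 <= 3 * N.
  case: n => [|n]; first by rewrite big_ord0 mulr_ge0// ltW.
  apply: le_trans (cauchy_weight_sum n N1) _.
  have : 0 <= 2 * N ^+ 2 / (N + n%:R).
    by rewrite divr_ge0 ?mulr_ge0 ?exprn_ge0 ?addr_ge0 ?(ltW N0).
  lra.
rewrite -(big_mkord xpredT (fun k => (1 + (N^-1 * (k%:Z - B%:Z)%:~R) ^+ 2)^-1)).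
rewrite (@big_cat_nat _ _ _ B)//=; last by rewrite mul2n -addnn -addnS leq_addr.
have -> : 6 * N = 3 * N + 3 * N by ring.
apply: lerD.
- rewrite big_nat_rev add0n big_mkord; apply: le_trans (le3 B).
  apply: ler_sum => i _; rewrite lef_pV2 ?posrE ?ltr_pwDl ?sqr_ge0// lerD2l.
  rewrite -subzn//.
  have -> : ((B%:Z - i.+1%:Z - B%:Z)%:~R : R) = - i.+1%:R.
    by rewrite addrAC subrr add0r rmorphN.
  rewrite mulrN sqrrN lerXn2r ?nnegrE ?mulr_ge0 ?invr_ge0 ?(ltW N0)//.
  by rewrite ler_pM2l ?invr_gt0// ler_nat.
- rewrite -{1}[B]add0n big_addn.
  rewrite (_ : (2 * B).+1 - B = B.+1)%N; last by rewrite mul2n -addnn subSn ?leq_addr// addnK.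
  rewrite big_mkord; apply: le_trans (le3 B.+1).
  by apply: ler_sum => i _; rewrite PoszD addrK.
Qed.

(** Expanding the product of the 1 + x_i^2 gives finitely many monomials, each
    bounded against [phi]. *)
Lemma schwartz_decay d (phi : 'rV[R]_d -> R) : schwartz phi ->
  exists2 C, 0 <= C & forall x : 'rV[R]_d,
    `|phi x| <= C * \prod_(i < d) (1 + x 0 i ^+ 2)^-1.
Proof.
move=> [_ h].
have /choice[C0 hC0] : forall J : {set 'I_d}, exists C, forall x : 'rV[R]_d,
    `|(\prod_(i < d) x 0 i ^+ (if i \in J then 2 else 0)) * phi x| <= C.
  by move=> J; have [C hC] := h (fun i => if i \in J then 2 else 0)%N [::]; exists C.
have C0_ge0 J : 0 <= C0 J by exact: le_trans (hC0 J 0).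
exists (\sum_J C0 J); first exact: sumr_ge0.
move=> x; rewrite prodfV ler_pdivlMr; last first.
  by apply: prodr_gt0 => i _; rewrite ltr_pwDl ?sqr_ge0.
under eq_bigr do rewrite addrC.
rewrite bigA_distr mulr_sumr; apply: ler_sum => J _; apply: le_trans (hC0 J x).
rewrite normrM mulrC ler_wpM2r// -[leLHS]ger0_norm; last first.
  by apply: prodr_ge0 => i _; case: ifP => // _; exact: sqr_ge0.
by rewrite (eq_bigr (fun i => x 0 i ^+ (if i \in J then 2 else 0)))// => i _; case: ifP.
Qed.

(** [phi] is dominated by a product weight, whose sum over a box is the product of
    the sums along the coordinates, each of them O(N). *)
Lemma schwartz_lattice_sum d (phi : 'rV[R]_d -> R) : schwartz phi ->
  exists2 C, 0 <= C & forall N : nat, (0 < N)%N ->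
    (\esum_(z in [set: lattice d]) `|phi (N%:R^-1 *: embed R z)|%:E <= (C * N%:R ^+ d)%:E)%E.
Proof.
move=> hphi; have [C C0 hC] := schwartz_decay hphi.
exists (C * 6 ^+ d); first by rewrite mulr_ge0// exprn_ge0.
move=> N N0; have N1 : 1 <= N%:R :> R by rewrite ler1n.
apply: esum_seq_le => s us _.
pose g (m : int) : R := (1 + (N%:R^-1 * m%:~R) ^+ 2)^-1.
have g0 m : 0 <= g m by rewrite invr_ge0 addr_ge0 ?sqr_ge0.
pose F (z : lattice d) := C * \prod_(i < d) g (z 0 i).
have F0 z : 0 <= F z by rewrite mulr_ge0// prodr_ge0.
(* a finite set of sites lies in a box, over which the product weight sums to a product *)
pose B := \max_(z <- s) \max_(i < d) absz (z 0%R i).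
pose zf (f : {ffun 'I_d -> 'I_(2 * B).+1}) : lattice d :=
  \row_i ((f i : nat)%:Z - B%:Z).
have zf_inj : injective zf.
  move=> f f' /matrixP E; apply/ffunP => i; have := E 0 i; rewrite !mxE.
  by move/addIr => [] /ord_inj.
have s_zf z : z \in s -> z \in map zf (enum {: {ffun 'I_d -> 'I_(2 * B).+1}}).
  move=> zs.
  have bd (i : 'I_d) : (`|z 0%R i| <= B)%N.
    apply: leq_trans (leq_bigmax_seq (F := fun z : lattice d => \max_(i < d) absz (z 0%R i)) z zs isT).
    exact: (leq_bigmax (F := fun i => absz (z 0%R i)) i).
  have bd' (i : 'I_d) : (`|(z 0%R i + B%:Z)%R| < (2 * B).+1)%N.
    by move: (bd i); move: (z _ i) => m; lia.
  apply/mapP; exists [ffun i => Ordinal (bd' i)]; first by rewrite mem_enum inE.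
  apply/matrixP => a i; rewrite !ord1 !mxE ffunE /=.
  by move: (bd i); move: (z _ i) => m; lia.
apply: (@le_trans _ _ (\sum_(z <- s) (F z)%:E)%E).
  rewrite !sumEFin lee_fin; apply: ler_sum => z _; apply: le_trans (hC _) _.
  rewrite ler_wpM2l// ler_prod// => i _; rewrite /g !mxE lexx andbT.
  by rewrite invr_ge0 addr_ge0 ?sqr_ge0.
have ue : uniq (map zf (enum {: {ffun 'I_d -> 'I_(2 * B).+1}})).
  by rewrite map_inj_uniq ?enum_uniq.
apply: (@le_trans _ _ (\esum_(z in [set` map zf (enum {: {ffun 'I_d -> 'I_(2 * B).+1}})]) (F z)%:E)%E).
  exact: le_seq_esum.
rewrite esum_fset//; last by move=> z _; rewrite lee_fin.
rewrite -fsbig_seq// big_map sumEFin lee_fin big_enum /=.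
rewrite (eq_bigr (fun f : {ffun 'I_d -> 'I_(2 * B).+1} =>
   C * \prod_(i < d) g ((f i : nat)%:Z - B%:Z))); last first.
  by move=> f _; congr (_ * _); apply: eq_bigr => i _; rewrite mxE.
rewrite -mulr_sumr -mulrA ler_wpM2l//.
rewrite -(bigA_distr_bigA (fun (i : 'I_d) (k : 'I_(2 * B).+1) => g ((k : nat)%:Z - B%:Z))).
rewrite prodr_const card_ord -exprMn lerXn2r ?nnegrE ?sumr_ge0 ?mulr_ge0//.
- exact: cauchy_weight_sumZ.
- exact: finite_seq.
Qed.
End schwartz_sum.

(** * Charlier polynomials and Poisson moments *)

Section charlier_recursions.
Context {R : realType} (rho : R).

Let big_extend (f : nat -> R) k : f k.+1 = 0 ->
  \sum_(j < k.+1) f j = \sum_(j < k.+2) f j.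
Proof. by move=> f0; rewrite [RHS]big_ord_recr /= f0 addr0. Qed.

(** Creation rule: multiplication by [n] is combined with the removal of one
    particle, the form in which Poisson variables can be integrated by parts. *)
Lemma charlier_degS k n : rho != 0 ->
  charlier rho k.+1 n = charlier rho k n - rho^-1 * n%:R * charlier rho k n.-1.
Proof.
move=> r0; rewrite /charlier big_ord_recl.
pose f j : R := 'C(k, j)%:R * (- rho) ^- j * (n ^_ j)%:R.
rewrite (@big_extend f k); last by rewrite /f bin_small// !mul0r.
rewrite [\sum_(j < k.+2) f j]big_ord_recl /f /= !bin0 -addrA; congr (_ + _).
rewrite mulr_sumr -sumrB; apply: eq_bigr => j _.
rewrite /bump /= add1n binS natrD exprS invfM ffactnS natrM.
by field; rewrite expf_neq0 ?r0 ?oppr_eq0.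
Qed.

(** Annihilation rule: the effect of one added particle is to lower the degree. *)
Lemma charlier_argS k n : rho != 0 ->
  charlier rho k n.+1 = charlier rho k n - rho^-1 * k%:R * charlier rho k.-1 n.
Proof.
move=> r0; rewrite /charlier.
case: k => [|k] /=; first by rewrite !big_ord1 !ffactn0 mulr0 mul0r subr0.
rewrite big_ord_recl [\sum_(j < k.+2) _]big_ord_recl /= !ffactn0 -addrA; congr (_ + _).
rewrite mulr_sumr -sumrB; apply: eq_bigr => j _.
rewrite /bump /= add1n ffactSS.
have -> : (n.+1 * n ^_ j)%:R = (n ^_ j.+1)%:R + j.+1%:R * (n ^_ j)%:R :> R.
  rewrite ffactnSr -!natrM -natrD; congr (_%:R).
  have [jn|nj] := leqP j n; first by nia.
  by rewrite ffact_small// !muln0.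
have : (k.+1%:R * 'C(k, j)%:R = 'C(k.+1, j.+1)%:R * j.+1%:R :> R).
  by rewrite -!natrM mul_bin_diag mulnC.
rewrite exprS invfM => E.
transitivity ('C(k.+1, j.+1)%:R * ((- rho)^-1 * (- rho) ^- j) * (n ^_ j.+1)%:R
  - rho^-1 * ('C(k.+1, j.+1)%:R * j.+1%:R) * ((- rho) ^- j) * (n ^_ j)%:R).
  by field; rewrite expf_neq0 ?r0 ?oppr_eq0.
by rewrite -E; ring.
Qed.

Lemma charlier0 n : charlier rho 0 n = 1.
Proof. by rewrite /charlier big_ord1 bin0 ffactn0 expr0 invr1 !mulr1. Qed.

End charlier_recursions.

Section falling_products.
Context {R : realType} {C : eqType}.
Implicit Types (js : seq C) (n : C -> nat) (j : C).

Definition decr (T : eqType) (j : T) (n : T -> nat) : T -> nat :=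
  fun i => (n i - (i == j))%N.
Definition incr (T : eqType) (j : T) (n : T -> nat) : T -> nat :=
  fun i => (n i + (i == j))%N.

(** Product over the classes [j] of the falling factorials of [n j], with exponent
    the multiplicity of [j] in [js]. A list is used, rather than a multiset, so
    that a particle can be added in front (multiplication by a coordinate) or at
    the back (removal of a particle). *)
Fixpoint falling js n : R :=
  if js is j :: js' then falling js' n * ((n j)%:R - (count_mem j js')%:R) else 1.

(** The new class is drawn first: its [n j] choices leave the counts
    [decr j n] for the other draws. *)
Lemma falling_rcons js j n :
  falling (rcons js j) n = (n j)%:R * falling js (decr j n).
Proof.
elim: js => [|i js IH] /=; first by rewrite mul1r subr0 mulr1.
rewrite IH -!mulrA; have [nj|nj] := posnP (n j); first by rewrite nj !mul0r.
congr (_ * (_ * _)); rewrite /decr -cats1 count_cat /= addn0 [j == i]eq_sym.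
case: eqVneq => [->|_] /=; rewrite ?subn0 ?addn0//.
by rewrite natrD natrB//; ring.
Qed.

Variables (good : pred C) (lam : C -> R).

(** [v] is the expectation of the polynomial [F] in independent Poisson variables
    of parameters [lam], computed formally: for such variables the falling
    products have expectation the product of the parameters. A relation, so that
    no uniqueness of the expansion of [F] has to be proved. Only the classes in
    [good] may occur, the others having possibly infinite counts. *)
Definition has_mean (F : (C -> nat) -> R) (v : R) := exists l : seq (R * seq C),
  [/\ (forall a, a \in l -> all good a.2),
      (forall n, F n = \sum_(a <- l) a.1 * falling a.2 n) &
      v = \sum_(a <- l) a.1 * \prod_(j <- a.2) lam j].

Lemma eq_has_mean F G v : (forall n, F n = G n) -> has_mean F v -> has_mean G v.
Proof. by move=> FG [l [h1 h2 h3]]; exists l; split => // n; rewrite -FG. Qed.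

Lemma has_mean_cst c : has_mean (fun=> c) c.
Proof.
exists [:: (c, [::])]; split; first by move=> a; rewrite inE => /eqP->.
- by move=> n; rewrite big_seq1 /= mulr1.
- by rewrite big_seq1 /= big_nil mulr1.
Qed.

Lemma has_meanD F G v w : has_mean F v -> has_mean G w ->
  has_mean (fun n => F n + G n) (v + w).
Proof.
move=> [l [h1 h2 ->]] [k [g1 g2 ->]]; exists (l ++ k); split.
- by move=> a; rewrite mem_cat => /orP[/h1|/g1].
- by move=> n; rewrite big_cat /= h2 g2.
- by rewrite big_cat.
Qed.

Lemma has_meanZ c F v : has_mean F v -> has_mean (fun n => c * F n) (c * v).
Proof.
move=> [l [h1 h2 ->]]; exists [seq (c * a.1, a.2) | a <- l]; split.
- by move=> _ /mapP[a al ->]; exact: (h1 a al).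
- by move=> n; rewrite h2 mulr_sumr big_map; apply: eq_bigr => a _; rewrite mulrA.
- by rewrite mulr_sumr big_map; apply: eq_bigr => a _; rewrite mulrA.
Qed.

Lemma has_mean_sum (I : eqType) (r : seq I) F v :
  (forall i, i \in r -> has_mean (F i) (v i)) ->
  has_mean (fun n => \sum_(i <- r) F i n) (\sum_(i <- r) v i).
Proof.
elim: r => [|i r IH] h.
  rewrite big_nil; apply: eq_has_mean (has_mean_cst 0) => n; by rewrite big_nil.
rewrite big_cons; apply: eq_has_mean (has_meanD (h i _) (IH _)).
- by move=> n /=; rewrite big_cons.
- by rewrite mem_head.
- by move=> j jr; apply: h; rewrite inE jr orbT.
Qed.

(** Mecke's formula E[N_j F(N - delta_j)] = lam_j E[F(N)]. *)
Lemma has_mean_mecke j F v : good j -> has_mean F v ->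
  has_mean (fun n => (n j)%:R * F (decr j n)) (lam j * v).
Proof.
move=> gj [l [h1 h2 ->]]; exists [seq (a.1, rcons a.2 j) | a <- l]; split.
- by move=> _ /mapP[a al ->] /=; rewrite all_rcons gj h1.
- move=> n; rewrite h2 mulr_sumr big_map; apply: eq_bigr => a _ /=.
  by rewrite falling_rcons mulrCA.
- rewrite mulr_sumr big_map; apply: eq_bigr => a _ /=.
  by rewrite -cats1 big_cat big_seq1 /= mulrCA [lam j * _]mulrC.
Qed.

(** Stability of the polynomials under products is only needed to know that some
    mean exists. Formulated as a property of one factor, it can be proved factor
    by factor. *)
Definition multiplier (P : (C -> nat) -> R) :=
  forall G v, has_mean G v -> exists w, has_mean (fun n => P n * G n) w.

Lemma eq_multiplier P Q : (forall n, P n = Q n) -> multiplier P -> multiplier Q.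
Proof.
by move=> PQ mP G v /mP[w hw]; exists w; apply: eq_has_mean hw => n; rewrite PQ.
Qed.

Lemma multiplier_cst c : multiplier (fun=> c).
Proof. by move=> G v h; exists (c * v); exact: has_meanZ. Qed.

Lemma multiplierD P Q : multiplier P -> multiplier Q ->
  multiplier (fun n => P n + Q n).
Proof.
move=> mP mQ G v h; have [w1 h1] := mP _ _ h; have [w2 h2] := mQ _ _ h.
by exists (w1 + w2); apply: eq_has_mean (has_meanD h1 h2) => n; rewrite mulrDl.
Qed.

Lemma multiplierM P Q : multiplier P -> multiplier Q ->
  multiplier (fun n => P n * Q n).
Proof.
move=> mP mQ G v /mQ[w /mP[u h]]; exists u.
by apply: eq_has_mean h => n; rewrite mulrA.
Qed.

Lemma multiplier_coord j : good j -> multiplier (fun n => (n j)%:R).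
Proof.
move=> gj G _ [l [h1 h2 _]].
suff [w hw] : exists w, has_mean (fun n => \sum_(a <- l) (n j)%:R * (a.1 * falling a.2 n)) w.
  by exists w; apply: eq_has_mean hw => n; rewrite h2 mulr_sumr.
have h a : a \in l -> has_mean (fun n => (n j)%:R * (a.1 * falling a.2 n))
    (\sum_(b <- [:: (a.1, j :: a.2); (a.1 * (count_mem j a.2)%:R, a.2)]) b.1 * \prod_(j <- b.2) lam j).
  move=> al; exists [:: (a.1, j :: a.2); (a.1 * (count_mem j a.2)%:R, a.2)]; split => //.
  - by move=> b; rewrite !inE => /orP[]/eqP-> /=; rewrite ?gj h1.
  - by move=> n; rewrite big_cons big_seq1 /=; ring.
by eexists; exact: has_mean_sum h.
Qed.

Lemma multiplier_sum (I : eqType) (r : seq I) P :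
  (forall i, i \in r -> multiplier (P i)) -> multiplier (fun n => \sum_(i <- r) P i n).
Proof.
elim: r => [|i r IH] h.
  by apply: eq_multiplier (multiplier_cst 0) => n; rewrite big_nil.
apply: (@eq_multiplier (fun n => P i n + \sum_(i <- r) P i n)).
  by move=> n; rewrite big_cons.
apply: multiplierD; first exact/h/mem_head.
by apply: IH => j jr; apply: h; rewrite inE jr orbT.
Qed.

Lemma multiplier_prod (I : eqType) (r : seq I) P :
  (forall i, i \in r -> multiplier (P i)) -> multiplier (fun n => \prod_(i <- r) P i n).
Proof.
elim: r => [|i r IH] h.
  by apply: eq_multiplier (multiplier_cst 1) => n; rewrite big_nil.
apply: (@eq_multiplier (fun n => P i n * \prod_(i <- r) P i n)).
  by move=> n; rewrite big_cons.
apply: multiplierM; first exact/h/mem_head.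
by apply: IH => j jr; apply: h; rewrite inE jr orbT.
Qed.

Lemma multiplier_charlier rho k (m : (C -> nat) -> nat) :
  multiplier (fun n => (m n)%:R) -> multiplier (fun n => charlier rho k (m n)).
Proof.
move=> mm; apply: multiplier_sum => j _; apply: multiplierM.
  exact: multiplier_cst.
elim: (nat_of_ord j) => [|i IH].
  by apply: eq_multiplier (multiplier_cst 1) => n; rewrite ffactn0.
apply: (@eq_multiplier (fun n => (m n ^_ i)%:R * ((m n)%:R + - i%:R))).
  move=> n; rewrite ffactnSr natrM.
  have [im|mi] := leqP i (m n); first by rewrite natrB.
  by rewrite ffact_small// !mul0r.
apply: multiplierM => //; apply: multiplierD => //; exact: multiplier_cst.
Qed.

End falling_products.

Lemma falling_prod (R : realType) (C : eqType) (X js : seq C) (n : C -> nat) :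
  uniq X -> {subset js <= X} ->
  falling js n = \prod_(x <- X) ((n x) ^_ (count_mem x js))%:R :> R.
Proof.
move=> uX; elim: js => [|j js IH] jX /=.
  by rewrite big1// => x _; rewrite ffactn0.
have jX' : j \in X by apply: jX; rewrite mem_head.
rewrite IH; last by move=> i ijs; apply: jX; rewrite inE ijs orbT.
rewrite !(big_rem j jX') /= eqxx add1n ffactnSr natrM mulrAC; congr (_ * _).
  have [le|lt] := leqP (count_mem j js) (n j); first by rewrite natrB.
  by rewrite ffact_small// !mul0r.
rewrite big_seq [RHS]big_seq; apply: eq_bigr => y.
by rewrite mem_rem_uniq// inE => /andP[yj _]; rewrite eq_sym (negbTE yj).
Qed.

Section charlier_products.
Context {R : realType} {S : eqType} (rho : R) (A : seq S).
Hypotheses (rho0 : 0 < rho) (uA : uniq A).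
Implicit Types (xs ys : seq S) (h : S -> nat).

(** The duality function of the particles [xs], restricted to a finite list of
    sites that contains them all. *)
Definition charlier_prod xs h : R :=
  \prod_(y <- A) charlier rho (count_mem y xs) (h y).

Lemma charlier_prod_cons x xs h : x \in A ->
  charlier_prod (x :: xs) h =
  charlier_prod xs h - rho^-1 * (h x)%:R * charlier_prod xs (decr x h).
Proof.
move=> xA; rewrite /charlier_prod !(big_rem x xA) /= eqxx add1n.
rewrite charlier_degS ?gt_eqF// mulrBl; congr (_ * _ - _).
- rewrite big_seq [RHS]big_seq; apply: eq_bigr => y.
  by rewrite mem_rem_uniq// inE => /andP[yx _]; rewrite eq_sym (negbTE yx).
- rewrite -!mulrA; congr (_ * (_ * (_ * _))).
    by rewrite /decr eqxx subn1.
  rewrite big_seq [RHS]big_seq; apply: eq_bigr => y.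
  rewrite mem_rem_uniq// inE => /andP[yx _].
  by rewrite /decr [x == y]eq_sym !(negbTE yx) subn0.
Qed.

Lemma charlier_prod_incr z xs h : z \in A ->
  charlier_prod xs (incr z h) =
  charlier_prod xs h - rho^-1 * (count_mem z xs)%:R * charlier_prod (rem z xs) h.
Proof.
move=> zA; rewrite /charlier_prod !(big_rem z zA) /=.
have -> : incr z h z = (h z).+1 by rewrite /incr eqxx addn1.
rewrite charlier_argS ?gt_eqF// mulrBl; congr (_ * _ - _).
- rewrite big_seq [RHS]big_seq; apply: eq_bigr => y.
  by rewrite mem_rem_uniq// inE => /andP[yz _]; rewrite /incr (negbTE yz) addn0.
- have [zxs|zxs] := boolP (z \in xs); last first.
    by rewrite (count_memPn zxs) mulr0 !mul0r.
  rewrite -!mulrA; congr (_ * (_ * (_ * _))).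
    by congr (charlier _ _ _); have /permP -> := perm_to_rem zxs; rewrite /= eqxx.
  rewrite big_seq [RHS]big_seq; apply: eq_bigr => y.
  rewrite mem_rem_uniq// inE => /andP[yz _]; rewrite /incr (negbTE yz) addn0.
  congr (charlier _ _ _); have /permP -> := perm_to_rem zxs.
  by rewrite /= eq_sym (negbTE yz).
Qed.

(** rho^-k times the permanent of the matrix of the P x y, expanded along the
    first row; the factor [count_mem z ys] is the number of particles of [ys] at
    [z] with which the particle at [x] can be matched. *)
Fixpoint pair_mean (P : S -> S -> R) xs ys : R :=
  if xs is x :: xs' then
    rho^-1 * \sum_(z <- A) P x z * (count_mem z ys)%:R * pair_mean P xs' (rem z ys)
  else 1.

Lemma sum_count_mem (f : S -> R) ys : {subset ys <= A} ->
  \sum_(z <- A) f z * (count_mem z ys)%:R = \sum_(y <- ys) f y.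
Proof.
elim: ys => [|y ys IH] yA.
  by rewrite big_nil big1// => z _; rewrite mulr0.
rewrite big_cons -IH; last by move=> z zy; apply: yA; rewrite inE zy orbT.
under eq_bigr do rewrite natrD mulrDr.
rewrite big_split /=; congr (_ + _).
have yA' : y \in A by apply: yA; rewrite mem_head.
rewrite (big_rem y yA') /= eqxx mulr1 big_seq big1 ?addr0// => z.
by rewrite mem_rem_uniq// inE => /andP[zy _]; rewrite eq_sym (negbTE zy) mulr0.
Qed.

Lemma pair_mean_bound (P : S -> S -> R) (M : R) xs ys :
  (forall x z, 0 <= P x z <= M) -> {subset ys <= A} -> size xs = size ys ->
  0 <= pair_mean P xs ys <= (size xs)`!%:R * (rho^-1 * M) ^+ size xs.
Proof.
move=> hP; elim: xs ys => [|x xs IH] ys yA /= sxy.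
  by rewrite expr0 fact0 mulr1 ler01 lexx.
have P0 z w : 0 <= P z w by case/andP: (hP z w).
have PM z w : P z w <= M by case/andP: (hP z w).
have r0 : 0 <= rho^-1 by rewrite invr_ge0 ltW.
have sub z : {subset rem z ys <= A} by move=> y /mem_rem/yA.
have szr z : z \in ys -> size xs = size (rem z ys).
  by move=> zy; rewrite size_rem// -sxy.
apply/andP; split.
  rewrite mulr_ge0//; apply: sumr_ge0 => z _.
  have [zy|zy] := boolP (z \in ys); last by rewrite (count_memPn zy) mulr0 mul0r.
  by rewrite !mulr_ge0//; case/andP: (IH _ (sub z) (szr z zy)).
set K := (size xs)`!%:R * (rho^-1 * M) ^+ size xs in IH *.
have K0 : 0 <= K.
  by rewrite mulr_ge0// exprn_ge0// mulr_ge0// (le_trans (P0 x x)).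
apply: (@le_trans _ _ (rho^-1 * \sum_(z <- A) (M * K) * (count_mem z ys)%:R)).
  rewrite ler_wpM2l//; apply: ler_sum => z _.
  have [zy|zy] := boolP (z \in ys); last by rewrite (count_memPn zy) !mulr0 mul0r.
  have /andP[I0 I1] := IH _ (sub z) (szr z zy).
  by rewrite mulrAC ler_wpM2r// ler_pM.
rewrite sum_count_mem// big_const_seq count_predT iter_addr addr0 -sxy /=.
by rewrite le_eqVlt; apply/orP; left; apply/eqP; rewrite /K factS natrM exprS -[_ *+ _]mulr_natr; ring.
Qed.

(** One of the factors [P] is kept, in order to be summed over the positions of
    the second configuration; all the others are bounded by [M]. *)
Lemma pair_mean_cons_bound (P : S -> S -> R) (M : R) x xs ys :
  (forall x z, 0 <= P x z <= M) -> {subset ys <= A} -> (size xs).+1 = size ys ->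
  pair_mean P (x :: xs) ys <=
    rho^-1 * (size xs)`!%:R * (rho^-1 * M) ^+ size xs * \sum_(y <- ys) P x y.
Proof.
move=> hP yA sxy /=.
have P0 z w : 0 <= P z w by case/andP: (hP z w).
have r0 : 0 <= rho^-1 by rewrite invr_ge0 ltW.
rewrite -!mulrA ler_wpM2l// -(sum_count_mem _ yA) mulrA mulr_sumr.
apply: ler_sum => z _.
have [zy|zy] := boolP (z \in ys); last by rewrite (count_memPn zy) !mulr0 mul0r.
rewrite mulrC ler_wpM2r ?mulr_ge0//.
have sub : {subset rem z ys <= A} by move=> y /mem_rem/yA.
have szr : size xs = size (rem z ys) by rewrite size_rem// -sxy.
by have /andP[] := pair_mean_bound hP sub szr.
Qed.

End charlier_products.

Section two_time_mean.
Context {R : realType} {S : eqType} (rho : R) (A : seq S).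
Hypotheses (rho0 : 0 < rho) (uA : uniq A).
Local Notation C := (option S * option S)%type.

(** A particle has the class [(a, b)], where [a] and [b] are its sites at the two
    times, or [None] for a site outside [A]. Infinitely many particles have the
    class [(None, None)], which no duality function supported in [A] sees. *)
Definition good_class : pred C := predC1 (None, None).
Definition site_options : seq (option S) := None :: map Some A.
Definition first_count (n : C -> nat) (y : S) : nat :=
  (\sum_(b <- site_options) n (Some y, b))%N.
Definition second_count (n : C -> nat) (z : S) : nat :=
  (\sum_(a <- site_options) n (a, Some z))%N.

Variables (lam : C -> R) (P : S -> S -> R).
Hypothesis lam_row : forall x, x \in A ->
  \sum_(b <- site_options) lam (Some x, b) = rho.
Hypothesis lam_pair : forall x z, x \in A -> z \in A ->
  lam (Some x, Some z) = rho * P x z.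

Lemma uniq_site_options : uniq site_options.
Proof.
rewrite /= map_inj_uniq ?uA ?andbT; last by move=> ? ? [].
by apply/mapP => -[].
Qed.

Lemma multiplier_charlier_prod1 xs :
  multiplier good_class lam (fun n => charlier_prod rho A xs (first_count n)).
Proof.
apply: multiplier_prod => y yA; apply: multiplier_charlier.
apply: (@eq_multiplier _ _ _ _ (fun n => \sum_(b <- site_options) (n (Some y, b))%:R)).
  by move=> n; rewrite natr_sum.
by apply: multiplier_sum => b _; apply: multiplier_coord.
Qed.

Lemma multiplier_charlier_prod2 ys :
  multiplier good_class lam (fun n => charlier_prod rho A ys (second_count n)).
Proof.
apply: multiplier_prod => y yA; apply: multiplier_charlier.
apply: (@eq_multiplier _ _ _ _ (fun n => \sum_(b <- site_options) (n (b, Some y))%:R)).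
  by move=> n; rewrite natr_sum.
by apply: multiplier_sum => b _; apply: multiplier_coord; case: b.
Qed.

Lemma has_mean_exists xs ys : exists v, has_mean good_class lam
  (fun n => charlier_prod rho A xs (first_count n) * charlier_prod rho A ys (second_count n)) v.
Proof.
have [w h] := @multiplier_charlier_prod2 ys _ _ (has_mean_cst good_class lam 1).
have [v hv] := @multiplier_charlier_prod1 xs _ _ h; exists v.
by apply: eq_has_mean hv => n; rewrite mulr1.
Qed.

Lemma first_count_decr x b n : (0 < n (Some x, b))%N -> b \in site_options ->
  first_count (decr (Some x, b) n) = decr x (first_count n).
Proof.
move=> n0 bo; apply/funext => y; rewrite /first_count /decr.
have [->|yx] := eqVneq y x; last first.
  by rewrite subn0; apply: eq_bigr => c _; rewrite xpair_eqE (inj_eq Some_inj) (negbTE yx) subn0.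
rewrite !(big_rem b bo) eqxx -addnBAC// ; congr addn.
rewrite big_seq [RHS]big_seq; apply: eq_bigr => c; rewrite mem_rem_uniq ?uniq_site_options// inE => /andP[cb _].
by rewrite xpair_eqE (negbTE cb) andbF subn0.
Qed.

Lemma second_count_decr_None x n :
  second_count (decr (Some x, None) n) = second_count n.
Proof.
apply/funext => z; rewrite /second_count /decr; apply: eq_bigr => a _.
by rewrite xpair_eqE andbF subn0.
Qed.

Lemma second_count_decr_Some x z n : (0 < n (Some x, Some z))%N -> x \in A ->
  incr z (second_count (decr (Some x, Some z) n)) = second_count n.
Proof.
move=> n0 xA; apply/funext => y; rewrite /second_count /decr /incr.
have [->|yz] := eqVneq y z; last first.
  rewrite addn0; apply: eq_bigr => c _.
  by rewrite xpair_eqE (inj_eq Some_inj) (negbTE yz) andbF subn0.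
have xo : Some x \in site_options by rewrite inE map_f ?orbT.
rewrite !(big_rem (Some x) xo) eqxx addnAC subnK//; congr addn.
rewrite big_seq [RHS]big_seq; apply: eq_bigr => c; rewrite mem_rem_uniq ?uniq_site_options// inE => /andP[cb _].
by rewrite xpair_eqE (negbTE cb) subn0.
Qed.

(** Induction on [xs]. The creation rule and Mecke's formula move the particle at
    [x] away, at the price of adding a particle of class [(Some x, b)]; the
    annihilation rule in the second factor matches it with a particle of [ys]. The
    terms without a match cancel because the masses of the classes [(Some x, b)]
    add up to [rho]. *)
Lemma has_mean_charlier_prod xs ys :
  {subset xs <= A} -> {subset ys <= A} -> size xs = size ys ->
  has_mean good_class lam
   (fun n => charlier_prod rho A xs (first_count n) * charlier_prod rho A ys (second_count n))
   (pair_mean rho A P xs ys).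
Proof.
elim: xs ys => [|x xs IH] ys xA yA.
  move=> /esym/eqP; rewrite size_eq0 => /eqP-> /=.
  apply: eq_has_mean (has_mean_cst _ _ 1) => n.
  by rewrite /charlier_prod !big1 ?mulr1// => y _; rewrite charlier0.
move=> /= sxy; have xA' : x \in A by apply: xA; rewrite mem_head.
have xsA : {subset xs <= A} by move=> z zx; apply: xA; rewrite inE zx orbT.
(* the sizes differ here, so only the existence of a mean is known; it cancels below *)
have [v0 hv0] := has_mean_exists xs ys.
pose F b n := charlier_prod rho A xs (first_count n) *
  charlier_prod rho A ys (if b is Some z then incr z (second_count n) else second_count n).
pose v b := if b is Some z then
  v0 - rho^-1 * (count_mem z ys)%:R * pair_mean rho A P xs (rem z ys) else v0.
have hF b : b \in site_options -> has_mean good_class lam (F b) (v b).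
  case: b => [z|_]; last exact: hv0.
  rewrite inE => /orP[//|/mapP[z' zA [zz']]]; subst z'.
  have [w hw] : exists w, has_mean good_class lam (fun n => - (rho^-1 * (count_mem z ys)%:R) *
      (charlier_prod rho A xs (first_count n) * charlier_prod rho A (rem z ys) (second_count n)))
     w /\ w = - (rho^-1 * (count_mem z ys)%:R) * pair_mean rho A P xs (rem z ys).
    have [zy|zy] := boolP (z \in ys).
      eexists; split; last reflexivity.
      apply: has_meanZ; apply: IH => //; first by move=> y /mem_rem/yA.
      by rewrite size_rem// -sxy.
    have [u hu] := has_mean_exists xs (rem z ys).
    exists (- (rho^-1 * (count_mem z ys)%:R) * u); split; first exact: has_meanZ.
    by rewrite (count_memPn zy) mulr0 oppr0 !mul0r.
  have -> : v (Some z) = v0 + w by rewrite hw.2 /v mulNr.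
  apply: eq_has_mean (has_meanD hv0 hw.1) => n.
  by rewrite /F charlier_prod_incr//; ring.
have hsum := has_mean_sum (r := site_options) (fun b hb =>
  has_mean_mecke (j := (Some x, b)) isT (hF b hb)).
have := has_meanD hv0 (has_meanZ (- rho^-1) hsum).
have -> : v0 + - rho^-1 * \sum_(b <- site_options) lam (Some x, b) * v b =
   pair_mean rho A P (x :: xs) ys.
  have lamE : \sum_(b <- site_options) lam (Some x, b) * v b =
    rho * v0 - \sum_(z <- A) P x z * (count_mem z ys)%:R * pair_mean rho A P xs (rem z ys).
    rewrite -[rho * v0](congr1 (fun r => r * v0) (lam_row xA')) /site_options !big_cons !big_map mulrDl -addrA; congr (_ + _).
    rewrite mulr_suml -sumrB big_seq [RHS]big_seq; apply: eq_bigr => z zA.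
    by rewrite lam_pair//=; field; rewrite gt_eqF.
  by rewrite lamE /=; field; rewrite gt_eqF.
apply: eq_has_mean => n.
rewrite charlier_prod_cons// mulrBl; congr (_ + _).
rewrite mulNr; congr (- _); rewrite -!mulrA; congr (_ * _).
rewrite [in RHS]/first_count natr_sum mulr_suml.
rewrite big_seq [RHS]big_seq; apply: eq_bigr => b bo.
have [n0|n0] := posnP (n (Some x, b)); first by rewrite n0 !mul0r.
congr (_ * _); rewrite /F first_count_decr//; congr (_ * charlier_prod _ _ _ _).
case: b bo n0 => [z|] bo n0; last exact: second_count_decr_None.
exact: second_count_decr_Some.
Qed.

End two_time_mean.

(** * Draws without replacement *)

Section counting_tuples.
Context {R : realType} {C : eqType} {T : choiceType}.
Implicit Types (K : C -> set T) (js : seq C) (ls : seq T) (n : C -> nat).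
Local Open Scope ereal_scope.

Lemma esum_card_eq (A : set T) m : (A #= `I_m)%card ->
  \esum_(i in A) (1 : \bar R) = m%:R%:E.
Proof.
move=> /card_set_bijP[f fb]; rewrite -(reindex_esum _ _ _ (fun=> 1 : \bar R) fb).
rewrite esum_fset//= -fsbig_ord sumEFin; congr EFin.
by rewrite sumr_const card_ord.
Qed.

Lemma esum_seq1 (s : seq T) (P : pred T) : uniq s ->
  \esum_(i in [set i | P i /\ i \in s]) (1 : \bar R) = (count P s)%:R%:E.
Proof.
move=> us; rewrite (_ : [set i | _] = [set` [seq i <- s | P i]]); last first.
  by apply/seteqP; split => i /=; rewrite mem_filter => /andP.
rewrite esum_fset// -?fsbig_seq ?filter_uniq//.
by rewrite sumEFin big_const_seq count_predT size_filter iter_addr addr0.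
Qed.

Fixpoint drawn_from K js ls : Prop :=
  match js, ls with
  | [::], [::] => True
  | j :: js', l :: ls' => [/\ K j l, l \notin ls' & drawn_from K js' ls']
  | _, _ => False
  end.

Lemma drawn_from_uniq K js ls : drawn_from K js ls -> uniq ls.
Proof. by elim: js ls => [|j js IH] [|l ls]//= [_ -> /IH]. Qed.

Lemma count_drawn_from K js ls j :
  (forall i i' l, K i l -> K i' l -> i = i') -> drawn_from K js ls ->
  count (fun l => `[< K j l >]) ls = count_mem j js.
Proof.
move=> dK; elim: js ls => [|i js IH] [|l ls]//= [Kil _ /IH ->]; congr (_ + _)%N.
by case: asboolP => [Kjl|nK]; [rewrite (dK _ _ _ Kil Kjl) eqxx|case: eqVneq => // ij; rewrite ij in Kil].
Qed.

(** Falling products count draws without replacement. With the other draws given,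
    the elements of [K j] already used are those drawn for the same class, the
    classes being disjoint. *)
Lemma count_draws K js n :
  (forall i i' l, K i l -> K i' l -> i = i') ->
  (forall j, j \in js -> (K j #= `I_(n j))%card) ->
  \esum_(ls in drawn_from K js) (1 : \bar R) = (falling js n : R)%:E.
Proof.
move=> dK; elim: js => [|j js IH] hK.
  rewrite (_ : drawn_from K [::] = [set [::]]); last first.
    by apply/seteqP; split => -[|l ls] //=.
  by rewrite esum_set1.
rewrite [in RHS]/=; have inner ls : drawn_from K js ls ->
    \esum_(l in [set l | K j l /\ l \notin ls]) (1 : \bar R) = ((n j)%:R - (count_mem j js)%:R)%:E.
  move=> dls; have := esum_card_eq (hK j (mem_head _ _)).
  rewrite (esumID [set l | l \in ls])//.
  have -> : K j `&` [set l | l \in ls] = [set l | (fun l => `[< K j l >]) l /\ l \in ls].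
    by apply/seteqP; split => l /=; [move=> [? ?]; split => //; exact/asboolP|move=> [/asboolP]].
  rewrite esum_seq1 ?(drawn_from_uniq dls)// (count_drawn_from _ dK dls).
  have -> : K j `&` ~` [set l | l \in ls] = [set l | K j l /\ l \notin ls].
    by apply/seteqP; split => l /= [? /negP].
  move=> h; rewrite EFinB -h addeAC subee ?add0e//.
rewrite (@reindex_esum _ _ _ (drawn_from K js `*`` (fun ls => [set l | K j l /\ l \notin ls]))
   _ (fun k => k.2 :: k.1)).
  rewrite -(@esum_esum _ _ _ _ _ (fun _ _ => 1))//.
  rewrite (eq_esum inner) EFinM -IH; last by move=> i ijs; apply: hK; rewrite inE ijs orbT.
  have [[ls dls]|no] := pselect (exists ls, drawn_from K js ls).
    rewrite -esumZr//; first by apply: eq_esum => ? _; rewrite mul1e.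
    by rewrite -lee_fin -(inner _ dls) esum_ge0.
  have -> : drawn_from K js = set0 :> set (seq T).
    by apply/seteqP; split => // ls dls; apply: no; exists ls.
  by rewrite !esum_set0 mul0e.
split => //=.
- by move=> [ls l] /= [h1 [h2 h3]]; split.
- by move=> [ls l] [ls' l'] _ _ /= [-> ->].
- by move=> [|l ls] //= [h1 h2 h3]; exists (ls, l).
Qed.
End counting_tuples.

(** * Particles with two-time marks *)

Section poisson_moments.
Context {R : realType}.
Local Open Scope ereal_scope.

Lemma poisson_factorial (rho : R) c : (0 < rho)%R ->
  \esum_(m in [set: nat]) ((m ^_ c)%:R * poisson_pmf rho m)%:E = (rho ^+ c)%:E.
Proof.
move=> r0; rewrite /poisson_pmf r0.
have t0 m : 0 <= ((m ^_ c)%:R * (rho ^+ m / m`!%:R * expR (- rho)))%:E.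
  by rewrite lee_fin !mulr_ge0 ?invr_ge0 ?expR_ge0 ?exprn_ge0 ?(ltW r0).
rewrite (_ : \esum_(m in _) _ = \esum_(m in [set m | (c <= m)%N])
    ((m ^_ c)%:R * (rho ^+ m / m`!%:R * expR (- rho)))%:E); last first.
  rewrite [RHS]esum_mkcond; apply: eq_esum => m _; case: ifPn => //.
  by rewrite notin_setE /= => /negP; rewrite -ltnNge => mc; rewrite ffact_small// mul0r.
rewrite (@reindex_esum _ _ _ [set: nat] _ (fun i => i + c)%N); last first.
  split => //=.
  - by move=> m _ /=; rewrite leq_addl.
  - by move=> m1 m2 _ _; exact: addIn.
  - by move=> n /= jn; exists (n - c)%N => //; rewrite subnK.
transitivity (\esum_(i in [set: nat]) ((rho ^+ c * expR (- rho))%:E * (rho ^+ i / i`!%:R)%:E)).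
  apply: eq_esum => i _; rewrite -EFinM; congr EFin.
  have := ffact_fact (leq_addl i c); rewrite addnK => /(congr1 (fun k => k%:R : R)%R).
  rewrite natrM => <-; rewrite exprD.
  have f0 : ((i + c) ^_ c)%:R != 0%R :> R by rewrite pnatr_eq0 -lt0n ffact_gt0 leq_addl.
  have g0 : i`!%:R != 0%R :> R by rewrite pnatr_eq0 -lt0n fact_gt0.
  by field; rewrite f0 g0.
rewrite esumZl; last 2 first.
- by rewrite mulr_ge0 ?exprn_ge0 ?expR_ge0 ?(ltW r0).
- by move=> i; rewrite lee_fin exp_coef_ge0 ?(ltW r0).
by rewrite esum_expR ?(ltW r0)// -EFinM -mulrA -expRD addNr expR0 mulr1.
Qed.
End poisson_moments.

Section countable_valued.
Local Open Scope ereal_scope.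

Lemma measurable_countable_valued d (Om : measurableType d) (S : countType)
    (X : Om -> S) (V : set S) :
  (forall a, measurable [set w | X w = a]) -> measurable [set w | V (X w)].
Proof.
move=> mX; rewrite (_ : [set w | _] = \bigcup_(a : S) (if a \in V then [set w | X w = a] else set0)).
  by apply: countable_bigcupT_measurable => // a; case: ifP => _.
apply/seteqP; split => w /=.
  by move=> Vw; exists (X w) => //; rewrite mem_set.
by move=> [a _]; case: ifPn => // /set_mem Va /= ->.
Qed.

(** The mutual independence hypothesis speaks of generated sigma-algebras; the
    events below depend on one or two countably valued variables. *)
Lemma generated_preimage (Om : pointedType) (S : countType) (J : Type) (D : set J)
    (X : J -> Om -> S) j (V : set S) : D j -> generated D X [set w | V (X j w)].
Proof.
move=> Dj; rewrite /generated; set G := (G in <<s G >>).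
apply: (@measurable_countable_valued _ (g_sigma_algebraType G) S (X j) V) => a.
by apply: sub_sigma_algebra; exists j => //; exists a.
Qed.

Lemma generated_preimage2 (Om : pointedType) (S : countType) (J : Type) (D : set J)
    (X : J -> Om -> S) i j (V : set (S * S)) : D i -> D j ->
  generated D X [set w | V (X i w, X j w)].
Proof.
move=> Di Dj; rewrite /generated; set G := (G in <<s G >>).
apply: (@measurable_countable_valued _ (g_sigma_algebraType G) _ (fun w => (X i w, X j w)) V) => -[a b].
rewrite (_ : [set w | _] = [set w | X i w = a] `&` [set w | X j w = b]); last first.
  by apply/seteqP; split => w /= [-> ->].
by apply: measurableI; apply: sub_sigma_algebra; [exists i|exists j] => //; eexists.
Qed.

End countable_valued.

Section initial_configuration.
Context {R : realType} {d : nat} (p : lattice d -> lattice d -> R) (rho : R).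
Context {disp : measure_display} {Om : measurableType disp} (P : probability Om R).
Context (eta : R -> Om -> lattice d -> nat).
Context (Y : lattice d * nat -> R -> Om -> lattice d).
Hypotheses (hp : jump_kernel p) (rho0 : 0 < rho).
Hypothesis hW : independent_walkers p rho P eta Y.
Local Notation L := (lattice d).
Local Notation label := (L * nat)%type.
Local Open Scope ereal_scope.

Lemma init_measurable x m : measurable [set w | eta 0%R w x = m].
Proof. by apply: (iw_meas hW). Qed.

Lemma init_joint (X : seq L) (v : L -> nat) : uniq X ->
  P [set w | forall x, x \in X -> eta 0%R w x = v x] =
  (\prod_(x <- X) poisson_pmf rho (v x))%:E.
Proof.
move=> uX.
pose E (a : L + label) := match a with
  | inl x => [set w | eta 0%R w x = v x] | inr _ => setT end.
have := iw_indep hW (J := map inl X) (E := E).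
rewrite map_inj_uniq; last by move=> ? ? [].
move=> /(_ uX) h; rewrite -prodEFin.
transitivity (P [set w | forall i, i \in map inl X -> E i w]).
  congr (P _); apply/seteqP; split => w /= hw.
    by move=> _ /mapP[x xX ->] /=; exact: hw.
  by move=> x xX; have := hw (inl x) (map_f _ xX).
rewrite h; last first.
  move=> _ /mapP[x xX ->] /=.
  exact: (@generated_preimage Om nat R [set 0%R] (fun t w => eta t w x) 0%R [set a | a = v x] erefl).
rewrite big_map; apply: eq_bigr => x _; exact: iw_init hW _ _.
Qed.

Lemma init_joint_measurable (X : seq L) (v : L -> nat) :
  measurable [set w | forall x, x \in X -> eta 0%R w x = v x].
Proof.
elim: X => [|x X IH].
  by rewrite (_ : [set w | _] = setT) //; apply/seteqP; split.
rewrite (_ : [set w | _] = [set w | eta 0%R w x = v x] `&`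
    [set w | forall x, x \in X -> eta 0%R w x = v x]).
  by apply: measurableI => //; exact: init_measurable.
apply/seteqP; split => w /=.
  by move=> h; split; [exact/h/mem_head|move=> y yX; apply: h; rewrite inE yX orbT].
by move=> [h1 h2] y; rewrite inE => /orP[/eqP->//|/h2].
Qed.

Lemma init_measurable_fun (g : nat -> R) x :
  measurable_fun [set: Om] (fun w => g (eta 0%R w x)).
Proof.
move=> _ B mB; rewrite setTI.
exact: (measurable_countable_valued (fun m => B (g m)) (fun m => init_measurable x m)).
Qed.

Lemma init_prod_measurable (f : L -> nat -> R) X :
  measurable_fun [set: Om] (fun w => \prod_(x <- X) f x (eta 0%R w x))%R.
Proof. by apply: measurable_prod => x _; exact: init_measurable_fun. Qed.

(** The variables are integrated one after the other. Conditioning on the value of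
    one of them creates an event of the form that the statement carries along. *)
Lemma init_prod_mean (f : L -> nat -> R) (F : L -> R) (X X2 : seq L) (v : L -> nat) :
  (forall x m, 0 <= f x m)%R ->
  (forall x, x \in X -> \esum_(m in [set: nat]) (f x m * poisson_pmf rho m)%:E = (F x)%:E) ->
  uniq (X ++ X2) ->
  \int[P]_w ((\prod_(x <- X) f x (eta 0%R w x)) *
     \1_[set w | forall x, x \in X2 -> eta 0%R w x = v x] w)%:E =
  (\prod_(x <- X) F x * \prod_(x <- X2) poisson_pmf rho (v x))%:E.
Proof.
move=> f0; elim: X X2 v => [|x X IH] X2 v hF uX.
  under eq_integral do rewrite big_nil mul1r.
  rewrite integral_indic ?setIT//; last exact: init_joint_measurable.
  rewrite big_nil mul1r; exact: init_joint.
pose v' m : L -> nat := fun y => if y == x then m else v y.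
have [xX xX2] : x \notin X /\ x \notin X2.
  by move: uX; rewrite cat_cons cons_uniq mem_cat negb_or => /andP[/andP[]].
have E w : ((\prod_(x <- x :: X) f x (eta 0%R w x)) *
     \1_[set w | forall x, x \in X2 -> eta 0%R w x = v x] w)%:E =
   \esum_(m in [set: nat]) ((f x m)%:E * ((\prod_(x <- X) f x (eta 0%R w x)) *
     \1_[set w | forall y, y \in x :: X2 -> eta 0%R w y = v' m y] w)%:E).
  rewrite (@esum_single _ _ _ (eta 0%R w x)).
  - rewrite big_cons -EFinM -mulrA; congr (_ * (_ * _))%:E.
    rewrite !indicE; congr (_%:R); congr (nat_of_bool _).
    apply/idP/idP; rewrite !inE /= => h.
      move=> y; rewrite inE /v'; case: eqVneq => [->//|_ /=]; exact: h.
    move=> y yX2; have := h y; rewrite inE yX2 orbT /v'.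
    by case: eqVneq => [yx|_]; [rewrite -yx yX2 in xX2|exact].
  - rewrite -EFinM lee_fin !mulr_ge0 ?prodr_ge0//.
  - move=> m mx; rewrite -EFinM indicE memNset ?mulr0//= => h.
    by have := h x (mem_head _ _); rewrite /v' eqxx => xm; rewrite xm eqxx in mx.
under eq_integral do rewrite E.
have mI m : measurable_fun [set: Om] (fun w : Om => (\prod_(x <- X) f x (eta 0%R w x)) *
     \1_[set w | forall y, y \in x :: X2 -> eta 0%R w y = v' m y] w)%R.
  apply: measurable_funM; first exact: init_prod_measurable.
  by apply: measurable_indic; exact: init_joint_measurable.
have I0 m w : 0 <= ((\prod_(x <- X) f x (eta 0%R w x)) *
     \1_[set w | forall y, y \in x :: X2 -> eta 0%R w y = v' m y] w)%:E.
  by rewrite lee_fin mulr_ge0 ?prodr_ge0.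
rewrite integral_esum; last 2 first.
- move=> m; apply: emeasurable_funM; [exact: measurable_cst|exact/measurable_EFinP].
- by move=> m w; apply: mule_ge0; [rewrite lee_fin|exact: I0].
rewrite (eq_esum (b := fun m => (f x m * poisson_pmf rho m)%:E *
   (\prod_(x <- X) F x * \prod_(x <- X2) poisson_pmf rho (v x))%:E)); last first.
  move=> m _; rewrite ge0_integralZl//; last by rewrite lee_fin.
    rewrite IH.
    - rewrite -!EFinM; congr EFin; rewrite big_cons /v' eqxx.
      rewrite (_ : \prod_(j <- X2) _ = \prod_(j <- X2) poisson_pmf rho (v j))%R; first ring.
      rewrite big_seq [RHS]big_seq; apply: eq_bigr => y yX2.
      by case: eqVneq => // yx; rewrite -yx yX2 in xX2.
    - by move=> y yX; apply: hF; rewrite inE yX orbT.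
    - by rewrite -cat1s uniq_catCA cat1s.
  exact/measurable_EFinP.
rewrite esumZr.
- by rewrite hF ?mem_head// -EFinM mulrA big_cons.
- rewrite mulr_ge0//; last by apply: prodr_ge0 => y _; exact: poisson_pmf_ge0.
  rewrite big_seq; apply: prodr_ge0 => y yX.
  rewrite -lee_fin -hF ?inE ?yX ?orbT//.
  by apply: esum_ge0 => m _; rewrite lee_fin mulr_ge0 ?poisson_pmf_ge0.
- by move=> m; rewrite lee_fin mulr_ge0 ?poisson_pmf_ge0.
Qed.


Lemma init_falling_mean (xs : seq L) :
  \int[P]_w (falling xs (eta 0%R w) : R)%:E = (rho ^+ size xs)%:E.
Proof.
have sub : {subset xs <= undup xs} by move=> x; rewrite mem_undup.
under eq_integral do rewrite (falling_prod _ _ (undup_uniq xs) sub).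
have := @init_prod_mean (fun x m => (m ^_ (count_mem x xs))%:R)
  (fun x => rho ^+ count_mem x xs)%R (undup xs) [::] (fun=> 0%N).
rewrite cats0 undup_uniq big_nil mulr1 => h.
transitivity (\prod_(x <- undup xs) rho ^+ count_mem x xs)%R%:E; last first.
  congr EFin; rewrite prodr_undup_exp_count big_const_seq count_predT.
  by rewrite iter_mulr mulr1.
rewrite -h//; last by move=> x _; exact: poisson_factorial.
apply: eq_integral => w _; rewrite indicE mem_set ?mulr1//.
Qed.

End initial_configuration.

Lemma uniq_map_inj (T U : eqType) (f : T -> U) (r : seq T) a b :
  uniq (map f r) -> a \in r -> b \in r -> f b = f a -> a = b.
Proof.
elim: r => [//|x r IH] /= /andP[xr ur]; rewrite !inE.
move=> /orP[/eqP->|ar] /orP[/eqP->|br] ba //; last exact: IH.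
  by rewrite -ba map_f in xr.
by rewrite ba map_f in xr.
Qed.

Section marked_particles.
Context {R : realType} {d : nat} (p : lattice d -> lattice d -> R) (rho : R).
Context {disp : measure_display} {Om : measurableType disp} (P : probability Om R).
Context (eta : R -> Om -> lattice d -> nat).
Context (Y : lattice d * nat -> R -> Om -> lattice d).
Hypotheses (hp : jump_kernel p) (rho0 : 0 < rho).
Hypothesis hW : independent_walkers p rho P eta Y.
Local Notation L := (lattice d).
Local Notation label := (L * nat)%type.
Local Notation C := (option L * option L)%type.
Context (A : seq L) (s t : R) (s0 : 0 <= s) (st : s <= t).
Local Open Scope ereal_scope.

Let t0 : (0 <= t)%R. Proof. exact: le_trans s0 st. Qed.
Let ts0 : (0 <= t - s)%R. Proof. by rewrite subr_ge0. Qed.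

Definition site_class (y : L) : option L := if y \in A then Some y else None.
Definition pair_class (yz : L * L) : C := (site_class yz.1, site_class yz.2).
Definition mark (l : label) (w : Om) : L * L := (Y l s w, Y l t w).

Lemma mark_measurable l (V : set (L * L)) : measurable [set w | V (mark l w)].
Proof.
apply: measurable_countable_valued => -[y z].
rewrite (_ : [set w | _] = [set w | Y l s w = y] `&` [set w | Y l t w = z]); last first.
  by apply/seteqP; split => w /= => [[-> ->]|[<- <-]].
by apply: measurableI; apply: (iw_walk hW l).1.
Qed.

(** The event is a countable union over pairs of sites, whose probabilities are
    finite-dimensional distributions of the walk. *)
Lemma mark_prob l (V : set (L * L)) :
  P [set w | V (mark l w)] =
  \esum_(yz in V) (heat_kernel p s l.1 yz.1 * heat_kernel p (t - s) yz.1 yz.2)%:E.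
Proof.
transitivity (\int[P]_w (\1_[set w | V (mark l w)] w)%:E).
  by rewrite integral_indic ?setIT//; exact: mark_measurable.
transitivity (\int[P]_w \esum_(yz in V) (\1_[set w | mark l w = yz] w)%:E).
  apply: eq_integral => w _; rewrite esum_mkcond (@esum_single _ _ _ (mark l w)).
  - case: ifPn => [/set_mem Vw|/negP Vw].
      by rewrite !indicE !mem_set.
    by rewrite indicE memNset// => h; apply: Vw; rewrite inE.
  - by case: ifP; rewrite ?lee_fin.
  - move=> yz yzw; case: ifP => // _; rewrite indicE memNset//= => h.
    by rewrite h eqxx in yzw.
rewrite integral_esum; last 2 first.
- move=> yz; apply/measurable_EFinP; apply: measurable_indic.
  exact: (mark_measurable l (fun a => a = yz)).
- by move=> yz w; rewrite lee_fin.
apply: eq_esum => -[y z] _; rewrite integral_indic ?setIT//; last first.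
  exact: (mark_measurable l (fun a => a = (y, z))).
have := (iw_walk hW l).2 [:: (s, y); (t, z)].
rewrite /= s0 st subr0 mulr1 => /(_ isT) <-.
congr (P _); apply/seteqP; split => w /=.
  by move=> [<- <-] u; rewrite !inE => /orP[]/eqP->.
move=> h; rewrite /mark (h (s, y)) ?(h (t, z))// ?inE ?eqxx ?orbT//.
Qed.

Definition class_prob (x : L) (j : C) : R :=
  fine (\esum_(yz in [set yz | pair_class yz = j])
    (heat_kernel p s x yz.1 * heat_kernel p (t - s) yz.1 yz.2)%:E).

Let trans_ge0 x (yz : L * L) :
  0 <= (heat_kernel p s x yz.1 * heat_kernel p (t - s) yz.1 yz.2)%:E.
Proof. by rewrite lee_fin mulr_ge0 ?heat_kernel_ge0. Qed.

Lemma class_prob_fin x j : (class_prob x j)%:E =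
  \esum_(yz in [set yz | pair_class yz = j])
    (heat_kernel p s x yz.1 * heat_kernel p (t - s) yz.1 yz.2)%:E.
Proof.
rewrite fineK// -(mark_prob (x, 0%N)).
exact: fin_num_measure (mark_measurable _ _).
Qed.

Lemma class_prob_ge0 x j : (0 <= class_prob x j)%R.
Proof. by rewrite fine_ge0// esum_ge0. Qed.

Definition in_use (l : label) (w : Om) : bool := (l.2 < eta 0%R w l.1)%N.

Definition site_set (w : Om) (x : L) : set label := [set l | in_use l w /\ l.1 = x].
Definition class_set (w : Om) (j : C) : set label :=
  [set l | in_use l w /\ pair_class (mark l w) = j].

Lemma drawn_siteP w xs ls : drawn_from (site_set w) xs ls <->
  [/\ uniq ls, map fst ls = xs & forall l, l \in ls -> in_use l w].
Proof.
elim: xs ls => [|x xs IH] [|l ls] /=; try by split => // -[].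
split=> [[[h1 h2] h3 /IH[h4 h5 h6]]|[/andP[h1 h2] [h3 h4] h5]].
  split; [by rewrite h3|by rewrite h2 h5|].
  by move=> k; rewrite inE => /orP[/eqP->//|/h6].
split => //; first by split => //; apply: h5; exact: mem_head.
by apply/IH; split => // k kls; apply: h5; rewrite inE kls orbT.
Qed.

Lemma drawn_classP w js ls : drawn_from (class_set w) js ls <->
  [/\ uniq ls, size ls = size js, forall l, l \in ls -> in_use l w &
    forall a, a \in zip ls js -> pair_class (mark a.1 w) = a.2].
Proof.
elim: js ls => [|j js IH] [|l ls] /=; try by split => // -[].
split=> [[[h1 h2] h3 /IH[h4 h5 h6 h7]]|[/andP[h1 h2] [h3] h4 h5]].
  split; [by rewrite h3|by rewrite h5| |].
  - by move=> k; rewrite inE => /orP[/eqP->//|/h6].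
  - by move=> k; rewrite inE => /orP[/eqP->//|/h7].
split => //; first by split; [apply: h4; exact: mem_head|exact: (h5 (l, j) (mem_head _ _))].
apply/IH; split => // k kls; first by apply: h4; rewrite inE kls orbT.
by apply: h5; rewrite inE kls orbT.
Qed.

Lemma in_use_measurable (ls : seq label) :
  measurable [set w | forall l, l \in ls -> in_use l w].
Proof.
elim: ls => [|l ls IH].
  by rewrite (_ : [set w | _] = setT) //; apply/seteqP; split.
rewrite (_ : [set w | _] = [set w | in_use l w] `&` [set w | forall l, l \in ls -> in_use l w]).
  apply: measurableI => //.
  exact: (measurable_countable_valued (fun m => (l.2 < m)%N) (fun m => init_measurable hW l.1 m)).
apply/seteqP; split => w /=.
  by move=> h; split; [exact/h/mem_head|move=> y yX; apply: h; rewrite inE yX orbT].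
by move=> [h1 h2] y; rewrite inE => /orP[/eqP->//|/h2].
Qed.

Lemma marks_measurable (s' : seq (label * C)) :
  measurable [set w | forall a, a \in s' -> pair_class (mark a.1 w) = a.2].
Proof.
elim: s' => [|a s' IH].
  by rewrite (_ : [set w | _] = setT) //; apply/seteqP; split.
rewrite (_ : [set w | _] = [set w | pair_class (mark a.1 w) = a.2] `&`
   [set w | forall a, a \in s' -> pair_class (mark a.1 w) = a.2]).
  by apply: measurableI => //; exact: (mark_measurable a.1 (fun yz => pair_class yz = a.2)).
apply/seteqP; split => w /=.
  by move=> h; split; [exact/h/mem_head|move=> y yX; apply: h; rewrite inE yX orbT].
by move=> [h1 h2] y; rewrite inE => /orP[/eqP->//|/h2].
Qed.

Definition in_use_prob (ls : seq label) : R :=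
  fine (P [set w | forall l, l \in ls -> in_use l w]).

Lemma in_use_probE ls : (in_use_prob ls)%:E = P [set w | forall l, l \in ls -> in_use l w].
Proof. by rewrite fineK// fin_num_measure//; exact: in_use_measurable. Qed.

Lemma in_use_prob_ge0 ls : (0 <= in_use_prob ls)%R.
Proof. by rewrite fine_ge0. Qed.

(** The labels in use are determined by the initial configuration, which is
    independent of the walks, and the walks of distinct labels are independent. *)
Lemma in_use_marks_prob (s' : seq (label * C)) : uniq (map fst s') ->
  P [set w | (forall l, l \in map fst s' -> in_use l w) /\
     forall a, a \in s' -> pair_class (mark a.1 w) = a.2] =
  (in_use_prob (map fst s') * \prod_(a <- s') class_prob a.1.1 a.2)%:E.
Proof.
move=> us; set ls := map fst s'.
(* independence is stated for distinct indices: the conditions on the labels with the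
   same initial site are gathered into one event *)
pose E (a : L + label) : set Om := match a with
  | inl x => [set w | forall l, l \in ls -> l.1 = x -> in_use l w]
  | inr l => [set w | forall a, a \in s' -> a.1 = l -> pair_class (mark l w) = a.2] end.
pose X := undup (map fst ls).
have uX : uniq (map (@inl L label) X) by rewrite map_inj_uniq ?undup_uniq// => ? ? [].
have uS : uniq (map (@inr L label) ls) by rewrite map_inj_uniq// => ? ? [].
have gen a : (match a with
       | inl x => generated [set 0%R : R] (fun t w => eta t w x)
       | inr l => generated [set t : R | (0 <= t)%R] (Y l)
       end) (E a).
  case: a => [x|l] /=.
    rewrite (_ : [set w | _] = [set w | [set m | forall l, l \in ls -> l.1 = x -> (l.2 < m)%N] (eta 0%R w x)]).
      exact: (@generated_preimage Om nat R [set 0%R] (fun t w => eta t w x) 0%R _ erefl).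
    apply/seteqP; split => w /= h l lls lx; first by have := h l lls lx; rewrite /in_use lx.
    by rewrite /in_use lx; exact: h.
  exact: (@generated_preimage2 Om L R [set t : R | (0 <= t)%R] (Y l) s t
    (fun yz => forall a, a \in s' -> a.1 = l -> pair_class yz = a.2) s0 t0).
have useE : P [set w | forall l, l \in ls -> in_use l w] = \prod_(x <- X) P (E (inl x)).
  have := iw_indep hW (E := E) uX (fun i _ => gen i); rewrite big_map => <-.
  congr (P _); apply/seteqP; split => w /= h.
    by move=> _ /mapP[x xX ->] /= l lls _; exact: h.
  move=> l lls; apply: (h (inl l.1) _ l lls erefl).
  by rewrite map_f// mem_undup map_f.
have uJ : uniq (map (@inl L label) X ++ map (@inr L label) ls).
  rewrite cat_uniq uX uS andbT; apply/hasPn => _ /mapP[l _ ->].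
  by apply/mapP => -[].
have := iw_indep hW (E := E) uJ (fun i _ => gen i).
rewrite big_cat !big_map -useE -in_use_probE EFinM.
rewrite (_ : [set w | forall i, _] = [set w | (forall l, l \in ls -> in_use l w) /\
     forall a, a \in s' -> pair_class (mark a.1 w) = a.2]); last first.
  apply/seteqP; split => w /=.
    move=> h; split.
      move=> l lls; apply: (h (inl l.1) _ l lls erefl).
      by rewrite mem_cat map_f// mem_undup map_f.
    move=> a as'; apply: (h (inr a.1) _ a as' erefl).
    by rewrite mem_cat orbC map_f// map_f.
  move=> [h1 h2] i; rewrite mem_cat => /orP[]/mapP[x xX ->] /=.
    by move=> l lls _; exact: h1.
  by move=> a as' <-; exact: h2.
move=> ->; congr (_ * _); rewrite -prodEFin big_seq [RHS]big_seq.
apply: eq_bigr => a as'; rewrite class_prob_fin -(mark_prob a.1).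
congr (P _); apply/seteqP; split => w /= h; first exact: h.
by move=> b bs' ba; rewrite h (uniq_map_inj us as' bs').
Qed.
End marked_particles.

Section class_draws.
Context {R : realType} {d : nat} (p : lattice d -> lattice d -> R) (rho : R).
Context {disp : measure_display} {Om : measurableType disp} (P : probability Om R).
Context (eta : R -> Om -> lattice d -> nat).
Context (Y : lattice d * nat -> R -> Om -> lattice d).
Hypotheses (hp : jump_kernel p) (rho0 : 0 < rho).
Hypothesis hW : independent_walkers p rho P eta Y.
Local Notation L := (lattice d).
Local Notation label := (L * nat)%type.
Local Notation C := (option L * option L)%type.
Context (A : seq L) (s t : R) (s0 : 0 <= s) (st : s <= t).
Local Open Scope ereal_scope.

Local Notation site_set := (site_set eta).
Local Notation class_set := (class_set eta Y A s t).
Local Notation class_prob := (class_prob p A s t).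
Local Notation in_use_prob := (in_use_prob P eta).

Lemma mean_number (D : Om -> set (seq label)) :
  (forall ls, measurable [set w | D w ls]) ->
  \int[P]_w (\esum_(ls in D w) 1) = \esum_(ls in [set: seq label]) P [set w | D w ls].
Proof.
move=> mD.
transitivity (\int[P]_w \esum_(ls in [set: seq label]) (\1_[set w | D w ls] w)%:E).
  apply: eq_integral => w _; rewrite esum_mkcond; apply: eq_esum => ls _.
  rewrite indicE; case: ifPn => [/set_mem h|/negP h]; first by rewrite mem_set.
  by rewrite memNset// => h'; apply: h; rewrite inE.
rewrite integral_esum; last 2 first.
- by move=> ls; apply/measurable_EFinP; exact: measurable_indic.
- by move=> ls w; rewrite lee_fin.
by apply: eq_esum => ls _; rewrite integral_indic ?setIT.
Qed.

Lemma drawn_site_measurable xs ls : measurable [set w | drawn_from (site_set w) xs ls].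
Proof.
have [ok|nok] := pselect (uniq ls /\ map fst ls = xs).
  rewrite (_ : [set w | _] = [set w | forall l, l \in ls -> in_use eta l w]).
    exact: (in_use_measurable hW).
  by apply/seteqP; split => w /=; [move/drawn_siteP => []|move=> h'; apply/drawn_siteP; split => //; case: ok].
rewrite (_ : [set w | _] = set0)//.
by apply/seteqP; split => w //= /drawn_siteP[h1 h2 _]; apply: nok.
Qed.

(** Summed over the draws with prescribed initial sites, the probabilities that
    all the labels are in use give a factorial moment of the initial Poisson
    variables. *)
Lemma site_draws_mean xs :
  \esum_(ls in [set ls | uniq ls /\ map fst ls = xs]) (in_use_prob ls)%:E = (rho ^+ size xs)%:E.
Proof.
rewrite -(init_falling_mean rho0 hW xs).
transitivity (\int[P]_w (\esum_(ls in drawn_from (site_set w) xs) 1)).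
  rewrite mean_number; last exact: drawn_site_measurable.
  rewrite esum_mkcond; apply: eq_esum => ls _; case: ifPn => [/set_mem[h1 h2]|/negP nok].
    rewrite (in_use_probE hW); congr (P _); apply/seteqP; split => w /=.
      by move=> h'; apply/drawn_siteP.
    by move/drawn_siteP => [].
  rewrite (_ : [set w | _] = set0) ?measure0//.
  by apply/seteqP; split => w //= /drawn_siteP[h1 h2 _]; apply: nok; rewrite inE.
apply: eq_integral => w _; apply: count_draws.
  by move=> x x' l [_ <-] [_ <-].
move=> x _; apply/card_set_bijP; exists snd; split.
- by move=> [x' m] /= [+ <-].
- by move=> [x1 m1] [x2 m2]; rewrite !inE => -[_ /= ->] [_ /= ->] ->.
- by move=> m /= mx; exists (x, m).
Qed.

Lemma drawn_class_measurable js ls : measurable [set w | drawn_from (class_set w) js ls].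
Proof.
have [ok|nok] := pselect (uniq ls /\ size ls = size js).
  rewrite (_ : [set w | _] = [set w | forall l, l \in ls -> in_use eta l w] `&`
     [set w | forall a, a \in zip ls js -> pair_class A (mark Y s t a.1 w) = a.2]).
    by apply: measurableI; [exact: (in_use_measurable hW)|exact: (marks_measurable hW)].
  apply/seteqP; split => w /=; first by move/drawn_classP => [].
  by move=> [h1 h2]; apply/drawn_classP; split => //; case: ok.
rewrite (_ : [set w | _] = set0)//.
by apply/seteqP; split => w //= /drawn_classP[h1 h2 _ _]; apply: nok.
Qed.

Lemma esum_prod_zip js (f : L -> C -> R) (m : C -> R) :
  (forall x j, (0 <= f x j)%R) ->
  (forall j, j \in js -> \esum_(x in [set: L]) (f x j)%:E = (m j)%:E) ->
  \esum_(xs in [set xs | size xs = size js]) (\prod_(a <- zip xs js) f a.1 a.2)%:E =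
  (\prod_(j <- js) m j)%:E.
Proof.
move=> f0; elim: js => [|j js IH] hm.
  rewrite (_ : [set xs | _] = [set [::]]); last first.
    by apply/seteqP; split => xs /=; [move/size0nil|move=> ->].
  by rewrite esum_set1/= ?big_nil// lee_fin.
rewrite (@reindex_esum _ _ _ ([set: L] `*`` (fun=> [set xs | size xs = size js]))
   _ (fun k => k.1 :: k.2)); last first.
  split => //=.
  - by move=> [x xs] /= [_ ->].
  - by move=> [x xs] [y ys] _ _ /= [-> ->].
  - by move=> [//|x xs] /= [hs]; exists (x, xs).
rewrite -(@esum_esum _ _ _ _ (fun=> [set xs | size xs = size js])
  (fun x xs => (\prod_(a <- zip (x :: xs) (j :: js)) f a.1 a.2)%:E)); last first.
  by move=> x xs _ _; rewrite lee_fin prodr_ge0.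
have P0 xs : (0 <= \prod_(a <- zip xs js) f a.1 a.2)%R by exact: prodr_ge0.
transitivity (\esum_(x in [set: L]) ((f x j)%:E * (\prod_(i <- js) m i)%:E)).
  apply: eq_esum => x _; rewrite -IH; last by move=> i ijs; apply: hm; rewrite inE ijs orbT.
  rewrite -esumZl//.
  by apply: eq_esum => xs _; rewrite /= big_cons EFinM.
rewrite esumZr.
- by rewrite hm ?mem_head// -EFinM big_cons.
- rewrite big_seq; apply: prodr_ge0 => i ijs; rewrite -lee_fin -hm ?inE ?ijs ?orbT//.
  by apply: esum_ge0 => x _; rewrite lee_fin.
- by move=> x; rewrite lee_fin.
Qed.

(** Thinning of Poisson variables at the level of factorial moments: the draws are
    grouped by the initial sites of the particles, on which alone the law of their
    classes depends. *)
Lemma class_draws_mean js (m : C -> R) :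
  (forall j, j \in js -> \esum_(x in [set: L]) (class_prob x j)%:E = (m j)%:E) ->
  \int[P]_w (\esum_(ls in drawn_from (class_set w) js) 1) =
  (\prod_(j <- js) (rho * m j))%:E.
Proof.
move=> hm; rewrite mean_number; last exact: drawn_class_measurable.
have q0 := class_prob_ge0 hp A s0 st.
pose Q xs := (\prod_(a <- zip xs js) class_prob a.1 a.2)%R.
have Q0 xs : (0 <= Q xs)%R by apply: prodr_ge0 => a _; exact: q0.
transitivity (\esum_(ls in [set ls | uniq ls /\ size ls = size js])
    ((in_use_prob ls * Q (map fst ls))%:E)).
  rewrite [RHS]esum_mkcond; apply: eq_esum => ls _; case: ifPn => [/set_mem[h1 h2]|/negP nok].
    have zE : map fst (zip ls js) = ls by rewrite -/unzip1 unzip1_zip ?h2.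
    have := @in_use_marks_prob _ _ _ _ _ _ _ _ _ hW A s t s0 st (zip ls js).
    rewrite zE => /(_ h1) e.
    rewrite (_ : [set w | _] = [set w | (forall l, l \in ls -> in_use eta l w) /\
      forall a, a \in zip ls js -> pair_class A (mark Y s t a.1 w) = a.2]).
      rewrite e; congr (_ * _)%:E; rewrite /Q.
      rewrite (_ : zip (map fst ls) js = [seq (a.1.1, a.2) | a <- zip ls js]) ?big_map//.
      by elim: (ls) (js) => [|l ls' IH] [|j js'] //=; rewrite IH.
    apply/seteqP; split => w /=; first by move/drawn_classP => [].
    by move=> [h3 h4]; apply/drawn_classP.
  rewrite (_ : [set w | _] = set0) ?measure0//.
  by apply/seteqP; split => w //= /drawn_classP[h1 h2 _ _]; apply: nok; rewrite inE.
rewrite (esum_partition (map fst)); last first.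
  by move=> ls; rewrite lee_fin mulr_ge0 ?in_use_prob_ge0.
transitivity (\esum_(xs in [set xs | size xs = size js]) ((Q xs)%:E * (rho ^+ size js)%:E)).
  rewrite [RHS]esum_mkcond; apply: eq_esum => xs _; case: ifPn => [/set_mem sxs|/negP nok].
    rewrite -sxs -site_draws_mean -esumZl//; last by move=> ls; rewrite lee_fin in_use_prob_ge0.
    rewrite (_ : [set i | _] = [set ls | uniq ls /\ map fst ls = xs]).
      by apply: eq_esum => ls [_ <-]; rewrite EFinM muleC.
    apply/seteqP; split => ls /=; first by move=> [[]].
    by move=> [h1 h2]; split => //; split => //; rewrite -?sxs -h2 size_map.
  rewrite (_ : [set i | _] = set0) ?esum_set0//.
  by apply/seteqP; split => ls //= [[_ h1] h2]; apply: nok; rewrite inE /= -h2 size_map.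
rewrite esumZr ?exprn_ge0 ?(ltW rho0)//.
rewrite (esum_prod_zip q0 hm) -EFinM big_split/= mulrC.
by rewrite big_const_seq count_predT iter_mulr mulr1.
Qed.

End class_draws.

(** * Two-time correlations *)

Lemma site_class_options (d : nat) (A : seq (lattice d)) y : site_class A y \in site_options A.
Proof. by rewrite /site_class; case: ifPn => yA; rewrite inE ?map_f ?orbT. Qed.

Section class_masses.
Context {R : realType} {d : nat} (p : lattice d -> lattice d -> R).
Hypothesis hp : jump_kernel p.
Local Notation L := (lattice d).
Local Notation C := (option L * option L)%type.
Context (A : seq L) (s t : R) (s0 : 0 <= s) (st : s <= t).
Local Open Scope ereal_scope.
Let ts0 : (0 <= t - s)%R. Proof. by rewrite subr_ge0. Qed.
Local Notation h := (heat_kernel p (t - s)).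

Definition class_mass (j : C) : R :=
  fine (\esum_(yz in [set yz | pair_class A yz = j]) (h yz.1 yz.2)%:E).

Let h0 y z : 0 <= (h y z)%:E. Proof. by rewrite lee_fin heat_kernel_ge0. Qed.

Lemma class_massE j : good_class j ->
  (class_mass j)%:E = \esum_(yz in [set yz | pair_class A yz = j]) (h yz.1 yz.2)%:E.
Proof.
move=> gj; rewrite fineK// ge0_fin_numE; last exact: esum_ge0.
apply: (@le_lt_trans _ _ 1); last exact: ltry.
case: j gj => -[y|] [z|] // _.
- rewrite -(heat_kernel_row hp y ts0).
  rewrite -(@esum_image _ _ (L * L)%type setT (fun z => (y, z)) (fun yz => (h yz.1 yz.2)%:E)); last by move=> ? ? _ _ [].
  apply: le_esum_sub => -[y' z'] /= [+ _]; rewrite /site_class; case: ifP => // _ [->].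
  by exists z'.
- rewrite -(heat_kernel_row hp y ts0).
  rewrite -(@esum_image _ _ (L * L)%type setT (fun z => (y, z)) (fun yz => (h yz.1 yz.2)%:E)); last by move=> ? ? _ _ [].
  apply: le_esum_sub => -[y' z'] /= [+ _]; rewrite /site_class; case: ifP => // _ [->].
  by exists z'.
- rewrite -(heat_kernel_col hp z ts0).
  rewrite -(@esum_image _ _ (L * L)%type setT (fun y => (y, z)) (fun yz => (h yz.1 yz.2)%:E)); last by move=> ? ? _ _ [].
  apply: le_esum_sub => -[y' z'] /= [_]; rewrite /site_class; case: ifP => // _ [->].
  by exists y'.
Qed.

Lemma class_mass_pair x z : x \in A -> z \in A -> class_mass (Some x, Some z) = h x z.
Proof.
move=> xA zA; rewrite /class_mass (_ : [set yz | _] = [set (x, z)]) ?esum_set1//.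
apply/seteqP; split => [[y w]|yz ->] /=; rewrite /pair_class /site_class /=.
  by case: ifP => // _; case: ifP => // _ [-> ->].
by rewrite xA zA.
Qed.

Lemma class_mass_row x : uniq A -> x \in A ->
  (\sum_(b <- site_options A) class_mass (Some x, b) = 1)%R.
Proof.
move=> uA xA; apply: EFin_inj; rewrite -sumEFin.
under eq_bigr do rewrite class_massE//.
rewrite -(heat_kernel_row hp x ts0).
rewrite (@esum_fibers _ _ _ _ (site_class A) setT _ (uniq_site_options uA))//; last first.
  by move=> z _; exact: site_class_options.
apply: eq_bigr => b _.
rewrite (@reindex_esum _ _ _ [set z | setT z /\ site_class A z = b] _ (fun z => (x, z)))//.
split => //=.
- by move=> z /= [_ <-]; rewrite /pair_class /= /site_class xA.
- by move=> ? ? _ _ [].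
- move=> [y z] /= []; rewrite {1}/site_class; case: ifP => // _ [->] zb.
  by exists z.
Qed.

End class_masses.

Section two_times.
Context {R : realType} {d : nat} (p : lattice d -> lattice d -> R) (rho : R).
Context {disp : measure_display} {Om : measurableType disp} (P : probability Om R).
Context (eta : R -> Om -> lattice d -> nat).
Context (Y : lattice d * nat -> R -> Om -> lattice d).
Hypotheses (hp : jump_kernel p) (rho0 : 0 < rho).
Hypothesis hW : independent_walkers p rho P eta Y.
Local Notation L := (lattice d).
Local Notation label := (L * nat)%type.
Local Notation C := (option L * option L)%type.
Context (A : seq L) (uA : uniq A) (s t : R) (s0 : 0 <= s) (st : s <= t).
Local Open Scope ereal_scope.

Let t0 : (0 <= t)%R. Proof. exact: le_trans s0 st. Qed.
Let ts0 : (0 <= t - s)%R. Proof. by rewrite subr_ge0. Qed.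
Local Notation h := (heat_kernel p (t - s)).
Local Notation class_set := (class_set eta Y A s t).
Local Notation class_mass := (class_mass p A s t).

(** Stationarity: the transition probabilities towards a site add up to 1. *)
Lemma class_prob_mass j : good_class j ->
  \esum_(x in [set: L]) (class_prob p A s t x j)%:E = (class_mass j)%:E.
Proof.
move=> gj; rewrite (class_massE hp)//.
under eq_esum do rewrite (class_prob_fin hW A s0 st).
rewrite exchange_esum; last by move=> x yz; rewrite lee_fin mulr_ge0 ?heat_kernel_ge0.
apply: eq_esum => yz _; under eq_esum do rewrite EFinM.
rewrite esumZr ?heat_kernel_ge0//; last by move=> x; rewrite lee_fin heat_kernel_ge0.
by rewrite (heat_kernel_col hp)// mul1e.
Qed.

Definition draws (js : seq C) (w : Om) : \bar R := \esum_(ls in drawn_from (class_set w) js) 1.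

Lemma draws_ge0 js w : 0 <= draws js w.
Proof. by apply: esum_ge0. Qed.

Lemma measurable_draws js : measurable_fun [set: Om] (draws js).
Proof.
rewrite (_ : draws js = fun w => \esum_(ls in [set: seq label])
    (\1_[set w | drawn_from (class_set w) js ls] w)%:E).
  apply: measurable_esum => // ls; apply/measurable_EFinP.
  by apply: measurable_indic; exact: (drawn_class_measurable hW).
apply/funext => w; rewrite /draws esum_mkcond; apply: eq_esum => ls _.
rewrite indicE; case: ifPn => [/set_mem hh|/negP hh]; first by rewrite mem_set.
by rewrite memNset// => h'; apply: hh; rewrite inE.
Qed.

Lemma integral_draws js : all good_class js ->
  \int[P]_w draws js w = (\prod_(j <- js) (rho * class_mass j))%:E.
Proof.
move=> gjs; apply: (class_draws_mean hp rho0 hW s0 st) => j jjs.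
by apply: class_prob_mass; exact: (allP gjs).
Qed.

Lemma integrable_draws js : all good_class js -> P.-integrable [set: Om] (draws js).
Proof.
move=> gjs; apply/integrableP; split; first exact: measurable_draws.
under eq_integral do rewrite gee0_abs ?draws_ge0//.
by rewrite integral_draws// ltry.
Qed.

(** Almost surely the number of particles at each site is finite, so every good
    class is finite, and both configurations are sums of class counts. *)
Lemma ae_class_counts : {ae P, forall w, exists n : C -> nat,
  [/\ forall j, good_class j -> (class_set w j #= `I_(n j))%card,
      forall y, y \in A -> eta s w y = first_count A n y &
      forall z, z \in A -> eta t w z = second_count A n z]}.
Proof.
apply: filterS2 (iw_count hW s0) (iw_count hW t0) => w hs ht.
pose u := fun l : label => in_use eta l w.
have fin j : exists m, good_class j -> (class_set w j #= `I_m)%card.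
  have [gj|ngj] := boolP (good_class j); last by exists 0%N.
  suff : finite_set (class_set w j) by move=> /finite_setP[m hm]; exists m.
  have fs y : finite_set [set l : label | (l.2 < eta 0%R w l.1)%N /\ Y l s w = y].
    by apply/finite_setP; eexists; exact: hs.
  have ft y : finite_set [set l : label | (l.2 < eta 0%R w l.1)%N /\ Y l t w = y].
    by apply/finite_setP; eexists; exact: ht.
  case: j gj => -[y|] [z|] // _.
  - apply: (sub_finite_set _ (fs y)) => l [/= ul]; rewrite /pair_class /site_class /=.
    by case: ifP => // _ [<-].
  - apply: (sub_finite_set _ (fs y)) => l [/= ul]; rewrite /pair_class /site_class /=.
    by case: ifP => // _ [<-].
  - apply: (sub_finite_set _ (ft z)) => l [/= ul]; rewrite /pair_class /site_class /=.
    by case: ifP => // _; case: ifP => // _ [<-].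
have [n hn] := choice fin; exists n; split => //.
- move=> y yA; apply/eqP; rewrite -(eqr_nat R) -eqe -(esum_card_eq (hs y)).
  rewrite /first_count natr_sum -sumEFin.
  rewrite (@esum_fibers _ _ _ _ (fun l => site_class A (Y l t w)) _ _ (uniq_site_options uA))//; last first.
    by move=> l _; exact: site_class_options.
  apply/eqP; apply: eq_bigr => b _; rewrite -(esum_card_eq (hn (Some y, b) isT)).
  congr (esum _ _); apply/seteqP; split => l /=; rewrite /class_set /pair_class /=.
    by move=> [[ul ly] lb]; split => //; rewrite ly {1}/site_class yA lb.
  move=> [ul [+ lb]]; rewrite {1}/site_class; case: ifP => // _ [ly].
  by split.
- move=> y yA; apply/eqP; rewrite -(eqr_nat R) -eqe -(esum_card_eq (ht y)).
  rewrite /second_count natr_sum -sumEFin.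
  rewrite (@esum_fibers _ _ _ _ (fun l => site_class A (Y l s w)) _ _ (uniq_site_options uA))//; last first.
    by move=> l _; exact: site_class_options.
  apply/eqP; apply: eq_bigr => b _.
  have gb : good_class (b, Some y) by case: b.
  rewrite -(esum_card_eq (hn (b, Some y) gb)).
  congr (esum _ _); apply/seteqP; split => l /=; rewrite /class_set /pair_class /=.
    by move=> [[ul ly] lb]; split => //; rewrite ly lb {1}/site_class yA.
  move=> [ul [lb]]; rewrite {1}/site_class; case: ifP => // _ [ly].
  by split.
Qed.

Lemma draws_falling w js (n : C -> nat) : all good_class js ->
  (forall j, good_class j -> (class_set w j #= `I_(n j))%card) ->
  draws js w = (falling js n)%:E.
Proof.
move=> gjs hn; apply: count_draws.
  by move=> j j' l [_ <-] [_ <-].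
by move=> j jjs; apply: hn; exact: (allP gjs).
Qed.

Lemma has_mean_integral (l : seq (R * seq C)) : (forall a, a \in l -> all good_class a.2) ->
  P.-integrable [set: Om] (fun w => \sum_(a <- l) a.1%:E * draws a.2 w) /\
  \int[P]_w (\sum_(a <- l) a.1%:E * draws a.2 w) =
  (\sum_(a <- l) a.1 * \prod_(j <- a.2) (rho * class_mass j))%:E.
Proof.
elim: l => [|a l IH] hl.
  split.
    rewrite (_ : (fun w => _) = cst 0); first exact: integrable0.
    by apply/funext => w; rewrite big_nil.
  by under eq_integral do rewrite big_nil; rewrite integral0 big_nil.
have ga : all good_class a.2 by apply: hl; rewrite mem_head.
have [I1 I2] := IH (fun b bl => hl b (mem_behead (s := a :: l) bl)).
have Ia := integrableZl measurableT a.1 (integrable_draws ga).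
split.
  rewrite (_ : (fun w => _) = (fun w => a.1%:E * draws a.2 w) \+
    (fun w => \sum_(a <- l) a.1%:E * draws a.2 w)); first exact: integrableD.
  by apply/funext => w; rewrite big_cons.
under eq_integral do rewrite big_cons.
rewrite integralD//= I2 integralZl ?integrable_draws// integral_draws// big_cons.
by rewrite -EFinM -EFinD.
Qed.

Lemma measurable_charlier_prod (xs : seq L) u : (0 <= u)%R ->
  measurable_fun [set: Om] (fun w => charlier_prod rho A xs (eta u w)).
Proof.
move=> u0; apply: measurable_prod => y _ _ B mB; rewrite setTI.
apply: (measurable_countable_valued (fun m => B (charlier rho (count_mem y xs) m))) => m.
by apply: (iw_meas hW).
Qed.

(** The product is almost surely the polynomial of [has_mean_charlier_prod] in the
    class counts, and the expectations of falling products of these counts are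
    those of independent Poisson variables. *)
Lemma two_time_charlier_mean (xs ys : seq L) :
  {subset xs <= A} -> {subset ys <= A} -> size xs = size ys ->
  P.-integrable [set: Om] (fun w =>
    (charlier_prod rho A xs (eta s w) * charlier_prod rho A ys (eta t w))%:E) /\
  \int[P]_w (charlier_prod rho A xs (eta s w) * charlier_prod rho A ys (eta t w))%:E =
  (pair_mean rho A h xs ys)%:E.
Proof.
move=> xsA ysA sxy.
have lam_row x : x \in A -> (\sum_(b <- site_options A) (rho * class_mass (Some x, b)) = rho)%R.
  by move=> xA; rewrite -mulr_sumr (class_mass_row hp)// mulr1.
have lam_pair x z : x \in A -> z \in A -> (rho * class_mass (Some x, Some z) = rho * h x z)%R.
  by move=> xA zA; rewrite class_mass_pair.
have [l [gl hl vl]] := has_mean_charlier_prod rho0 uA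
  (lam := fun j => rho * class_mass j)%R h lam_row lam_pair xs ys xsA ysA sxy.
have [Il El] := has_mean_integral gl.
have mW : measurable_fun [set: Om] (fun w =>
    (charlier_prod rho A xs (eta s w) * charlier_prod rho A ys (eta t w))%:E).
  apply/measurable_EFinP; apply: measurable_funM; exact: measurable_charlier_prod.
have aeE : ae_eq P setT (fun w =>
    (charlier_prod rho A xs (eta s w) * charlier_prod rho A ys (eta t w))%:E)
    (fun w => \sum_(a <- l) a.1%:E * draws a.2 w).
  apply: filterS ae_class_counts => w [n [h1 h2 h3]] _.
  rewrite (_ : charlier_prod rho A xs _ = charlier_prod rho A xs (first_count A n)); last first.
    by rewrite /charlier_prod big_seq [RHS]big_seq; apply: eq_bigr => y yA; rewrite h2.
  rewrite (_ : charlier_prod rho A ys _ = charlier_prod rho A ys (second_count A n)); last first.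
    by rewrite /charlier_prod big_seq [RHS]big_seq; apply: eq_bigr => y yA; rewrite h3.
  rewrite hl -sumEFin big_seq [RHS]big_seq; apply: eq_bigr => a al.
  by rewrite (draws_falling (gl a al) h1) EFinM.
have mS := measurable_int _ Il.
split.
  apply/integrableP; split => //.
  have /integrableP[_] := Il; congr (_ < _); apply: ae_eq_integral => //.
  - exact: measurableT_comp.
  - exact: measurableT_comp.
  - by apply: filterS aeE => w h /h ->.
by rewrite (ae_eq_integral _ _ measurableT mW mS aeE) El vl.
Qed.

End two_times.

(** * Products of infinite random sums *)

Section unconditional_sums.
Context {R : realType} (T : countType).
Implicit Types (f g : T -> R).

Definition partial_sum f (n : nat) : R := \sum_(0 <= i < n) oapp f 0 (pickle_inv i).

Definition first_points (n : nat) : seq T := pmap (@pickle_inv T) (iota 0 n).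

Lemma uniq_first_points n : uniq (first_points n).
Proof. by apply: (pmap_uniq (g := pickle)); [exact: pickle_invK|exact: iota_uniq]. Qed.

Lemma partial_sumE f n : partial_sum f n = \sum_(z <- first_points n) f z.
Proof.
rewrite /partial_sum /first_points /index_iota subn0.
elim: (iota 0 n) => [|i r IH]; first by rewrite !big_nil.
by rewrite big_cons IH /=; case: pickle_inv => [z|] /=; rewrite ?big_cons ?add0r.
Qed.

Lemma cvg_partial_sum_ge0 g : (forall z, 0 <= g z) ->
  (\esum_(z in [set: T]) (g z)%:E < +oo)%E ->
  partial_sum g @ \oo --> fine (\esum_(z in [set: T]) (g z)%:E).
Proof.
move=> g0 gfin.
have E0 : (0 <= \esum_(z in [set: T]) (g z)%:E)%E by apply: esum_ge0 => z _; rewrite lee_fin.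
have Efin : \esum_(z in [set: T]) (g z)%:E \is a fin_num by rewrite ge0_fin_numE.
suff h : (partial_sum g n)%:E @[n --> \oo] --> (fine (\esum_(z in [set: T]) (g z)%:E))%:E.
  exact: (fine_cvg h).
rewrite fineK// (esum_series (a := EFin \o g)); last by move=> z; rewrite lee_fin.
rewrite (_ : (fun n => _) = (fun n => \sum_(0 <= i < n) oapp (EFin \o g) 0%E (pickle_inv i))%E); last first.
  apply/funext => n; rewrite /partial_sum -sumEFin; apply: eq_bigr => i _.
  by case: pickle_inv.
apply: is_cvg_nneseries => n _ _; by case: pickle_inv => //= z; rewrite lee_fin.
Qed.

Lemma cvg_partial_sum f :
  (\esum_(z in [set: T]) `|f z|%:E < +oo)%E -> partial_sum f @ \oo --> rsum f.
Proof.
move=> ffin.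
have fp : (\esum_(z in [set: T]) (f^\+ z)%:E < +oo)%E.
  apply: le_lt_trans ffin; apply: le_esum => z _; rewrite lee_fin /funrpos.
  by rewrite ge_max normr_ge0 ler_norm.
have fn : (\esum_(z in [set: T]) (f^\- z)%:E < +oo)%E.
  apply: le_lt_trans ffin; apply: le_esum => z _; rewrite lee_fin /funrneg.
  by rewrite ge_max normr_ge0 -normrN ler_norm.
have c1 := cvg_partial_sum_ge0 (funrpos_ge0 f) fp.
have c2 := cvg_partial_sum_ge0 (funrneg_ge0 f) fn.
rewrite (_ : partial_sum f = fun n => partial_sum f^\+ n - partial_sum f^\- n).
  exact: cvgB c1 c2.
apply/funext => n; rewrite /partial_sum -sumrB.
apply: eq_bigr => i _; case: pickle_inv => [z|] /=; last by rewrite subrr.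
by have := congr1 (fun g => g z) (funrposBneg f).
Qed.

End unconditional_sums.

Section product_of_sums.
Context {R : realType} {T : countType} {disp : measure_display}
  {Om : measurableType disp} (P : probability Om R).
Context (c : T -> R) (D1 D2 : T -> Om -> R) (K B : R).
Hypothesis m1 : forall z, measurable_fun [set: Om] (D1 z).
Hypothesis m2 : forall z, measurable_fun [set: Om] (D2 z).
Hypothesis hc : (\esum_(z in [set: T]) `|c z|%:E < +oo)%E.
Hypothesis sq1 : forall z, (\int[P]_w (D1 z w ^+ 2)%:E <= K%:E)%E.
Hypothesis sq2 : forall z, (\int[P]_w (D2 z w ^+ 2)%:E <= K%:E)%E.
Hypothesis finite_bound : forall Z : seq T, uniq Z ->
  (\int[P]_w ((\sum_(z <- Z) c z * D1 z w) * (\sum_(z <- Z) c z * D2 z w))%:E <= B%:E)%E.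

(* the term 1 ensures that finiteness of the sum also gives absolute convergence *)
Let G z w : R := `|c z| * (1 + D1 z w ^+ 2 + D2 z w ^+ 2).

Let G0 z w : 0 <= G z w.
Proof. by rewrite mulr_ge0 ?addr_ge0 ?sqr_ge0. Qed.

Let mG z : measurable_fun [set: Om] (fun w => (G z w)%:E).
Proof.
apply/measurable_EFinP; apply: measurable_funM; first exact: measurable_cst.
by apply: measurable_funD; [apply: measurable_funD|]; [exact: measurable_cst|apply: measurable_funX..].
Qed.

Let H w : \bar R := \esum_(z in [set: T]) (G z w)%:E.

Let mH : measurable_fun [set: Om] H.
Proof. by apply: measurable_esum => // z w; rewrite lee_fin. Qed.

Let H0 w : (0 <= H w)%E. Proof. by apply: esum_ge0 => z _; rewrite lee_fin. Qed.

Let K0 (z : T) : 0 <= K.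
Proof. by rewrite -lee_fin; apply: le_trans (sq1 z); apply: integral_ge0 => w _; rewrite lee_fin sqr_ge0. Qed.

Let integral_H : (\int[P]_w H w < +oo)%E.
Proof.
rewrite integral_esum//.
apply: (@le_lt_trans _ _ (\esum_(z in [set: T]) (`|c z|%:E * (1 + K + K)%:E))%E).
  apply: le_esum => z _.
  rewrite /G; under eq_integral do rewrite EFinM.
  rewrite ge0_integralZl//; last 2 first.
  - by apply/measurable_EFinP; apply: measurable_funD; [apply: measurable_funD|]; [exact: measurable_cst|apply: measurable_funX..].
  - by move=> w _; rewrite lee_fin ?addr_ge0 ?sqr_ge0.
  rewrite lee_wpmul2l ?lee_fin//.
  under eq_integral do rewrite 2!EFinD.
  rewrite ge0_integralD//; last 4 first.
  - by move=> w _; rewrite -EFinD lee_fin addr_ge0 ?sqr_ge0.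
  - by apply: emeasurable_funD => //; apply/measurable_EFinP; exact: measurable_funX.
  - by move=> w _; rewrite lee_fin sqr_ge0.
  - by apply/measurable_EFinP; exact: measurable_funX.
  rewrite ge0_integralD//; last 2 first.
  - by move=> w _; rewrite lee_fin sqr_ge0.
  - by apply/measurable_EFinP; exact: measurable_funX.
  have -> : (\int[P]_x 1%:E = 1)%E by rewrite integral_cst// mul1e; exact: probability_setT.
  rewrite 2!EFinD.
  by apply: leeD => //; apply: leeD.
have [[z0]|T0] := pselect (exists z : T, True); last first.
  rewrite esum1 ?ltry// => z; exfalso; apply: T0; by exists z.
move=> _; rewrite esumZr.
- by rewrite lte_mul_pinfty ?ge0_fin_numE// ?esum_ge0// ltry.
- by rewrite !addr_ge0 ?(K0 z0).
- by move=> z; rewrite lee_fin.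
Qed.

Let Cc := fine (\esum_(z in [set: T]) `|c z|%:E).

Let sum_c_le (Z : seq T) : uniq Z -> \sum_(z <- Z) `|c z| <= Cc.
Proof.
move=> uZ; rewrite -lee_fin fineK; last by rewrite ge0_fin_numE// esum_ge0.
by rewrite -sumEFin; exact: le_seq_esum.
Qed.

Let dominated (Z : seq T) w : uniq Z ->
  (`|((\sum_(z <- Z) c z * D1 z w) * (\sum_(z <- Z) c z * D2 z w))%:E| <= Cc%:E * H w)%E.
Proof.
move=> uZ; apply: (@le_trans _ _ (Cc * \sum_(z <- Z) G z w)%:E).
  rewrite abse_EFin lee_fin normrM.
  apply: (@le_trans _ _ ((\sum_(z <- Z) `|c z| * `|D1 z w|) * (\sum_(z <- Z) `|c z| * `|D2 z w|))).
    by apply: ler_pM => //; apply: le_trans (ler_norm_sum _ _ _) _; apply: ler_sum => z _; rewrite normrM.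
  apply: (@le_trans _ _ ((\sum_(z <- Z) `|c z|) * \sum_(z <- Z) G z w)); last first.
    by rewrite ler_wpM2r ?sum_c_le// sumr_ge0.
  set S := \sum_(z <- Z) `|c z|.
  apply: (@le_trans _ _ (\sum_(z <- Z) \sum_(z' <- Z) `|c z| * `|c z'| * ((D1 z w ^+ 2 + D2 z' w ^+ 2) / 2))).
    rewrite mulr_suml; apply: ler_sum => z _; rewrite mulr_sumr; apply: ler_sum => z' _.
    rewrite mulrACA ler_wpM2l ?mulr_ge0//.
    rewrite -(real_normK (num_real (D1 z w))) -(real_normK (num_real (D2 z' w))).
    have := sqr_ge0 (`|D1 z w| - `|D2 z' w|); nra.
  have -> : \sum_(z <- Z) \sum_(z' <- Z) `|c z| * `|c z'| * ((D1 z w ^+ 2 + D2 z' w ^+ 2) / 2) =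
     S * (\sum_(z <- Z) `|c z| * (D1 z w ^+ 2 / 2 + D2 z w ^+ 2 / 2)).
    under eq_bigr => z _.
      rewrite (eq_bigr (fun z' => (`|c z| * (D1 z w ^+ 2 / 2)) * `|c z'| + `|c z| * (`|c z'| * (D2 z' w ^+ 2 / 2)))); last by move=> z' _; ring.
      rewrite big_split /= -!mulr_sumr -/S; over.
    rewrite big_split /= -!mulr_suml -/S.
    rewrite [X in _ = S * X](eq_bigr (fun z => `|c z| * (D1 z w ^+ 2 / 2) + `|c z| * (D2 z w ^+ 2 / 2))); last by move=> z _; ring.
    by rewrite big_split /=; ring.
  rewrite ler_wpM2l ?sumr_ge0//; apply: ler_sum => z _; rewrite ler_wpM2l//.
  have := sqr_ge0 (D1 z w); have := sqr_ge0 (D2 z w); lra.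
rewrite EFinM lee_wpmul2l ?lee_fin//; first by rewrite fine_ge0// esum_ge0.
by rewrite -sumEFin; exact: le_seq_esum.
Qed.

Let summable_at (D : T -> Om -> R) w : (forall z, `|D z w| <= 1 + D1 z w ^+ 2 + D2 z w ^+ 2) ->
  (H w < +oo)%E -> (\esum_(z in [set: T]) `|c z * D z w|%:E < +oo)%E.
Proof.
move=> hD; apply: le_lt_trans; apply: le_esum => z _; rewrite lee_fin normrM.
by rewrite ler_wpM2l.
Qed.

Lemma measurable_rsum (D : T -> Om -> R) : (forall z, measurable_fun [set: Om] (D z)) ->
  measurable_fun [set: Om] (fun w => rsum (fun z => c z * D z w)).
Proof.
move=> mD; have mcD z : measurable_fun [set: Om] (fun w => c z * D z w).
  by apply: measurable_funM => //; exact: measurable_cst.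
apply: measurable_funB.
- apply: measurableT_comp => //; apply: measurable_esum.
    by move=> z; apply/measurable_EFinP; exact: measurable_funrpos.
  by move=> z w; rewrite lee_fin funrpos_ge0.
- apply: measurableT_comp => //; apply: measurable_esum.
    by move=> z; apply/measurable_EFinP; exact: measurable_funrneg.
  by move=> z w; rewrite lee_fin funrneg_ge0.
Qed.

(** The partial sums along an enumeration converge almost surely, and their
    products are dominated by a multiple of the sum of the
    |c_z| (1 + D1_z^2 + D2_z^2), whose mean is finite. *)
Lemma mean_product_rsum_le :
  (\int[P]_w (rsum (fun z => (c z * D1 z w)%R) * rsum (fun z => (c z * D2 z w)%R))%:E <= B%:E)%E.
Proof.
pose S1 n w := partial_sum (fun z => c z * D1 z w) n.
pose S2 n w := partial_sum (fun z => c z * D2 z w) n.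
have mS (D : T -> Om -> R) n : (forall z, measurable_fun [set: Om] (D z)) ->
    measurable_fun [set: Om] (fun w => partial_sum (fun z => c z * D z w) n).
  move=> mD; rewrite (_ : (fun w => _) = fun w => \sum_(z <- first_points T n) c z * D z w); last first.
    by apply/funext => w; rewrite partial_sumE.
  apply: measurable_sum => z; apply: measurable_funM => //; exact: measurable_cst.
have Hae : {ae P, forall w, (H w < +oo)%E}.
  have iH : P.-integrable [set: Om] H.
    by apply/integrableP; split => //; under eq_integral do rewrite gee0_abs//.
  apply: filterS (integrable_ae measurableT iH) => w /(_ I).
  by rewrite ge0_fin_numE.
have iG : P.-integrable [set: Om] (fun w => Cc%:E * H w)%E.
  apply: integrableZl => //.
  by apply/integrableP; split => //; under eq_integral do rewrite gee0_abs//.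
have := @dominated_convergence _ _ _ P setT measurableT (fun n w => (S1 n w * S2 n w)%:E)
  (fun w => (rsum (fun z => c z * D1 z w) * rsum (fun z => c z * D2 z w))%:E)
  (fun w => Cc%:E * H w)%E.
case.
- by move=> n; apply/measurable_EFinP; apply: measurable_funM; exact: mS.
- by apply/measurable_EFinP; apply: measurable_funM; exact: measurable_rsum.
- apply: filterS Hae => w Hw _; apply: cvg_EFin; first exact: nearW.
  apply: cvgM; apply: cvg_partial_sum; apply: summable_at => // z.
    have := sqr_ge0 (D2 z w); have := sqr_ge0 (`|D1 z w| - 1).
    rewrite -(real_normK (num_real (D1 z w))); nra.
  have := sqr_ge0 (D1 z w); have := sqr_ge0 (`|D2 z w| - 1).
  rewrite -(real_normK (num_real (D2 z w))); nra.
- exact: iG.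
- apply: nearW => w n _; rewrite /S1 /S2 !partial_sumE.
  by apply: dominated; exact: uniq_first_points.
move=> _ _ cvI; rewrite -(cvg_lim _ cvI)//.
apply: lime_le; first by apply/cvg_ex; eexists; exact: cvI.
apply: nearW => n /=; rewrite /S1 /S2; under eq_integral do rewrite !partial_sumE.
by apply: finite_bound; exact: uniq_first_points.
Qed.

End product_of_sums.

(** * The fluctuation field *)

Section duality_as_product.
Context {R : realType} {d k : nat} (rho : R) (x : 'I_k -> lattice d).

Definition translates (z : lattice d) : seq (lattice d) := [seq z + x i | i <- enum 'I_k].

Lemma size_translates z : size (translates z) = k.
Proof. by rewrite size_map size_enum_ord. Qed.

Lemma dirac_sum_count z y : dirac_sum (translate z x) y = count_mem y (translates z).
Proof.
rewrite /dirac_sum /translates count_map -sum1_count [RHS]big_mkcond -[LHS]big_enum.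
by apply: eq_bigr => i _ /=; rewrite /translate; case: eqP.
Qed.

Lemma duality_charlier_prod (A : seq (lattice d)) z h : uniq A -> {subset translates z <= A} ->
  duality rho (dirac_sum (translate z x)) h = charlier_prod rho A (translates z) h.
Proof.
move=> uA sA; rewrite /duality (fsbigE A)//; last first.
  move=> y _ yA; rewrite dirac_sum_count (count_memPn _) ?charlier0//.
  by apply: contra yA; exact: sA.
rewrite /charlier_prod; apply: eq_big => [y|y _]; first by rewrite in_setT.
by rewrite dirac_sum_count.
Qed.

End duality_as_product.

Section field_mean.
Context {R : realType} {d : nat} (p : lattice d -> lattice d -> R) (rho : R).
Context {disp : measure_display} {Om : measurableType disp} (P : probability Om R).
Context (eta : R -> Om -> lattice d -> nat).
Context (Y : lattice d * nat -> R -> Om -> lattice d).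
Hypotheses (hp : jump_kernel p) (rho0 : 0 < rho).
Hypothesis hW : independent_walkers p rho P eta Y.
Context (k : nat) (x : 'I_k.+1 -> lattice d).
Local Notation L := (lattice d).
Local Notation D z u w := (duality rho (dirac_sum (translate z x)) (eta u w)).
Local Open Scope ereal_scope.

Lemma measurable_duality z u : (0 <= u)%R -> measurable_fun [set: Om] (fun w => D z u w).
Proof.
move=> u0; rewrite (_ : (fun w => _) = fun w => charlier_prod rho (undup (translates x z)) (translates x z) (eta u w)).
  exact: (measurable_charlier_prod hW).
apply/funext => w; apply: duality_charlier_prod; first exact: undup_uniq.
by move=> y; rewrite mem_undup.
Qed.

Variables (s t M : R).
Hypotheses (s0 : (0 <= s)%R) (st : (s <= t)%R).
Hypothesis hM : forall y z, (heat_kernel p (t - s) y z <= M)%R.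
Let ts0 : (0 <= t - s)%R. Proof. by rewrite subr_ge0. Qed.
Local Notation h := (heat_kernel p (t - s)).

Let M0 : (0 <= M)%R.
Proof. exact: le_trans (heat_kernel_ge0 hp 0%R 0%R ts0) (hM _ _). Qed.

(** The two bounds have different uses: the uniform one gives second moments, and
    the other one can be summed over [z']. *)
Lemma duality_pair_mean z z' : exists m : R,
  [/\ P.-integrable [set: Om] (fun w => (D z s w * D z' t w)%:E),
      \int[P]_w (D z s w * D z' t w)%:E = m%:E,
      (0 <= m <= k.+1`!%:R * (rho^-1 * M) ^+ k.+1)%R &
      (m <= rho^-1 * k`!%:R * (rho^-1 * M) ^+ k *
          \sum_(i < k.+1) h (z + x ord0) (z' + x i))%R].
Proof.
pose A := undup (translates x z ++ translates x z').
have uA : uniq A by exact: undup_uniq.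
have zA : {subset translates x z <= A} by move=> y yz; rewrite mem_undup mem_cat yz.
have zA' : {subset translates x z' <= A} by move=> y yz; rewrite mem_undup mem_cat yz orbT.
have szz : size (translates x z) = size (translates x z') by rewrite !size_translates.
have [I E] := two_time_charlier_mean hp rho0 hW uA s0 st zA zA' szz.
have eqD w : (D z s w * D z' t w = charlier_prod rho A (translates x z) (eta s w) *
    charlier_prod rho A (translates x z') (eta t w))%R.
  by rewrite (duality_charlier_prod _ _ uA zA) (duality_charlier_prod _ _ uA zA').
have hb y y' : (0 <= h y y' <= M)%R by rewrite hM heat_kernel_ge0.
exists (pair_mean rho A h (translates x z) (translates x z')); split.
- by under eq_fun do rewrite eqD.
- by under eq_integral do rewrite eqD.
- by have := @pair_mean_bound _ _ _ A rho0 uA h M _ _ hb zA' szz; rewrite size_translates.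
- have E' : translates x z = (z + x ord0)%R :: [seq (z + x (lift ord0 i))%R | i <- enum 'I_k].
    by rewrite /translates enum_ordSl /= -map_comp.
  have szs : (size [seq (z + x (lift ord0 i))%R | i <- enum 'I_k]).+1 = size (translates x z').
    by rewrite size_map size_enum_ord size_translates.
  have := @pair_mean_cons_bound _ _ _ A rho0 uA h M (z + x ord0)%R _ _ hb zA' szs.
  rewrite -E' size_map size_enum_ord => hh; apply: le_trans hh _.
  by rewrite [X in (_ * X <= _)%R]big_map big_enum.
Qed.

(** The correlations are nonnegative, so the weights may be replaced by absolute
    values; the sum over [z'] of the transition probability left over is at most 1
    for each particle. *)
Lemma finite_field_mean_le (c : L -> R) (b S : R) (Z : seq L) : uniq Z ->
  (forall z, `|c z| <= b)%R -> (\sum_(z <- Z) `|c z| <= S)%R ->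
  \int[P]_w ((\sum_(z <- Z) c z * D z s w) * (\sum_(z <- Z) c z * D z t w))%:E <=
  (rho^-1 * k`!%:R * (rho^-1 * M) ^+ k * k.+1%:R * b * S)%:E.
Proof.
move=> uZ cb cS.
have b0 : (0 <= b)%R by exact: le_trans (cb 0%R).
have r0 : (0 <= rho^-1)%R by rewrite invr_ge0 ltW.
set K0 := (rho^-1 * k`!%:R * (rho^-1 * M) ^+ k)%R.
have K00 : (0 <= K0)%R by rewrite !mulr_ge0// exprn_ge0// mulr_ge0.
have /choice[m hm] : forall zz : L * L, exists m : R,
    [/\ P.-integrable [set: Om] (fun w => (D zz.1 s w * D zz.2 t w)%:E),
      \int[P]_w (D zz.1 s w * D zz.2 t w)%:E = m%:E, (0 <= m)%R &
      (m <= K0 * \sum_(i < k.+1) h (zz.1 + x ord0) (zz.2 + x i))%R].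
  move=> zz; have [m [h1 h2 /andP[h3 _] h4]] := duality_pair_mean zz.1 zz.2.
  by exists m; split.
have -> : \int[P]_w ((\sum_(z <- Z) c z * D z s w) * (\sum_(z <- Z) c z * D z t w))%:E =
   (\sum_(z <- Z) \sum_(z' <- Z) c z * c z' * m (z, z'))%:E.
  under eq_integral => w _.
    rewrite mulr_suml -sumEFin; under eq_bigr => z _.
      rewrite mulr_sumr -sumEFin; under eq_bigr => z' _ do rewrite mulrACA EFinM.
      over.
    over.
  have Iz z : P.-integrable [set: Om]
      (fun w => \sum_(z' <- Z) (c z * c z')%:E * (D z s w * D z' t w)%:E).
    by apply: integrable_sum => // z' _; apply: integrableZl => //; have [] := hm (z, z').
  rewrite integral_sum//.
  rewrite -sumEFin; apply: eq_bigr => z _.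
  rewrite (integral_sum measurableT); last first.
    by move=> z'; apply: integrableZl => //; have [] := hm (z, z').
  rewrite -sumEFin; apply: eq_bigr => z' _.
  have [I1 I2 _ _] := hm (z, z').
  by rewrite integralZl// I2 EFinM.
rewrite lee_fin.
apply: (@le_trans _ _ (\sum_(z <- Z) `|c z| * (b * K0 * k.+1%:R))%R); last first.
  rewrite -mulr_suml; apply: (@le_trans _ _ (S * (b * K0 * k.+1%:R))%R).
    by apply: ler_wpM2r => //; apply: mulr_ge0 => //; apply: mulr_ge0.
  by rewrite le_eqVlt; apply/orP; left; apply/eqP; ring.
apply: ler_sum => z _.
apply: (@le_trans _ _ (`|c z| * (b * (K0 * \sum_(z' <- Z) \sum_(i < k.+1) h (z + x ord0) (z' + x i))))%R).
  rewrite 2!mulr_sumr mulr_sumr; apply: ler_sum => z' _; have [_ _ m0 ml] := hm (z, z').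
  apply: (@le_trans _ _ (`|c z| * (b * m (z, z')))%R); last first.
    by rewrite ler_wpM2l// ler_wpM2l.
  rewrite -mulrA; apply: le_trans (ler_norm _) _; rewrite normrM ler_wpM2l//.
  by rewrite normrM (ger0_norm m0) ler_wpM2r.
rewrite ler_wpM2l// -mulrA ler_wpM2l// ler_wpM2l//.
rewrite exchange_big /= (_ : k.+1%:R = \sum_(i < k.+1) 1)%R; last by rewrite sumr_const card_ord.
apply: ler_sum => i _; rewrite -lee_fin -(heat_kernel_row hp (z + x ord0)%R ts0) -sumEFin.
rewrite -(big_map (fun z' => z' + x i)%R xpredT (fun y => (h (z + x ord0)%R y)%:E)).
apply: le_seq_esum => //; rewrite map_inj_uniq//; exact: addIr.
Qed.

End field_mean.

Lemma field_mean_le (R : realType) (d : nat) (p : lattice d -> lattice d -> R) (rho : R)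
    (disp : measure_display) (Om : measurableType disp) (P : probability Om R)
    (eta : R -> Om -> lattice d -> nat) (Y : lattice d * nat -> R -> Om -> lattice d)
    (hp : jump_kernel p) (rho0 : 0 < rho) (hW : independent_walkers p rho P eta Y)
    (k : nat) (x : 'I_k.+1 -> lattice d) (phi : 'rV[R]_d -> R) (N : nat) (s t M b S : R) :
  0 <= s -> s <= t -> (forall y z, heat_kernel p (t - s) y z <= M) ->
  (forall y, `|phi y| <= b) ->
  (\esum_(z in [set: lattice d]) `|phi (N%:R^-1 *: embed R z)|%:E <= S%:E)%E ->
  (\int[P]_w (fluctuation_field rho N x (eta s w) phi *
     fluctuation_field rho N x (eta t w) phi)%:E <=
  (rho^-1 * k`!%:R * (rho^-1 * M) ^+ k * k.+1%:R * b * S)%:E)%E.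
Proof.
move=> s0 st hM phib sumS; have t0 : 0 <= t by exact: le_trans s0 st.
have second u z : 0 <= u ->
    (\int[P]_w ((duality rho (dirac_sum (translate z x)) (eta u w)) ^+ 2)%:E <=
      (k.+1`!%:R * (rho^-1 * 1) ^+ k.+1)%:E)%E.
  move=> u0; have h1 y y' : heat_kernel p (u - u) y y' <= 1.
    by apply: heat_kernel_le1 => //; rewrite subrr.
  have [m [_ E /andP[_ mb] _]] := duality_pair_mean hp rho0 hW x u0 (lexx u) h1 z z.
  by under eq_integral do rewrite expr2; rewrite E lee_fin.
apply: (@mean_product_rsum_le _ (lattice d) _ _ P (fun z => phi (N%:R^-1 *: embed R z))
  (fun z w => duality rho (dirac_sum (translate z x)) (eta s w))
  (fun z w => duality rho (dirac_sum (translate z x)) (eta t w))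
  (k.+1`!%:R * (rho^-1 * 1) ^+ k.+1)).
- by move=> z; exact: (measurable_duality hW).
- by move=> z; exact: (measurable_duality hW).
- by apply: le_lt_trans sumS _; exact: ltry.
- by move=> z; exact: second.
- by move=> z; exact: second.
- move=> Z uZ; have cS : \sum_(z <- Z) `|phi (N%:R^-1 *: embed R z)| <= S.
    by rewrite -lee_fin -sumEFin; apply: le_trans sumS; exact: le_seq_esum.
  exact: (finite_field_mean_le hp rho0 hW x s0 st hM uZ (fun z => phib _) cS).
Qed.

Section integral_bounds.
Context {R : realType}.
Local Open Scope ereal_scope.

(** The integral of a nonnegative function is a supremum over the simple functions
    below it, hence is monotone on arbitrary functions. The correlations are
    integrated over the two times in this way. *)
Lemma le_integral_ge0 d (T : measurableType d) (mu : {measure set T -> \bar R})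
    (D : set T) (f g : T -> \bar R) :
  (forall x, D x -> 0 <= g x) -> (forall x, D x -> f x <= g x) ->
  \int[mu]_(x in D) f x <= \int[mu]_(x in D) g x.
Proof.
move=> g0 fg; rewrite integralE.
apply: (@le_trans _ _ (\int[mu]_(x in D) f^\+ x)).
  by apply: geeDl; rewrite oppe_le0; apply: integral_ge0 => x _; exact: funeneg_ge0.
rewrite !ge0_integralE//.
apply: le_ereal_sup => _ [h /= hf <-]; exists h => // x; apply: le_trans (hf x) _.
rewrite /patch; case: ifPn => // /set_mem Dx.
by rewrite funeposE ge_max fg//= g0.
Qed.

Lemma integral_near_diagonal (T e B W t : R) : (0 <= T)%R -> (0 < e)%R -> (0 <= B)%R -> (0 <= W)%R ->
  \int[lebesgue_measure]_(s in `[0%R, T])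
     (B%:E * ((\1_`](t - e)%R, (t + e)%R[ s)%:E + W%:E)) <= (B * (2 * e + T * W))%:E.
Proof.
move=> T0 e0 B0 W0.
rewrite ge0_integralZl//; last 2 first.
- apply: emeasurable_funD; last exact: measurable_cst.
  by apply/measurable_EFinP; apply: measurable_indic.
- by move=> s _; rewrite adde_ge0 ?lee_fin.
rewrite EFinM lee_wpmul2l ?lee_fin//.
rewrite ge0_integralD//; last by apply/measurable_EFinP; apply: measurable_indic.
rewrite integral_indic// integral_cst// EFinD; apply: leeD.
  apply: (@le_trans _ _ (lebesgue_measure `](t - e)%R, (t + e)%R[)).
    by apply: le_measure; rewrite ?inE//; exact: measurableI.
  rewrite lebesgue_measure_itv /= lte_fin ltrD2l gtrN//.
  by rewrite -EFinB lee_fin; lra.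
apply: (@le_trans _ _ (W%:E * lebesgue_measure `[0%R, T])) => //.
rewrite lebesgue_measure_itv /= lte_fin; case: ltP => T0'.
  by rewrite -EFinB subr0 -EFinM mulrC.
by rewrite mule0 lee_fin mulr_ge0.
Qed.

End integral_bounds.

(** The value N^e, with e = -2a/(2+a), equates the contribution eps of the time
    pairs closer than eps with that of the other ones, (N^2 eps)^(-a/2). *)
Lemma optimal_cutoff (R : realType) (N : R) (a : nat) : 0 < N ->
  let e := - (2 * a%:R) / (2 + a%:R) in
  Num.sqrt (N ^+ 2 * N `^ e) ^- a = N `^ e.
Proof.
move=> N0 /=; set e := - (2 * a%:R) / (2 + a%:R).
have a2 : 2 + a%:R != 0 :> R by rewrite gt_eqF// ltr_wpDr.
have -> : N ^+ 2 * N `^ e = (N `^ (1 + e / 2)) ^+ 2.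
  rewrite -powR_mulrn ?ltW// -[RHS]powR_mulrn ?powR_ge0// -powRD; last first.
    by rewrite (gt_eqF N0) implybT.
  by rewrite -powRrM; congr (_ `^ _); field.
rewrite sqrtr_sqr ger0_norm ?powR_ge0// -powR_mulrn ?powR_ge0// -powRrM -powRN.
by congr (_ `^ _); rewrite /e; field.
Qed.

Theorem theorem3p2 (R : realType) (d : nat) (hd : (1 <= d)%N)
    (p : lattice d -> lattice d -> R) (hp : jump_kernel p)
    (rho : R) (hrho : 0 < rho)
    (k : nat) (hk : (1 <= k)%N) (x : 'I_k -> lattice d)
    (phi : 'rV[R]_d -> R) (hphi : schwartz phi) :
  forall T : R, 0 < T -> exists C : R, \forall N \near \oo,
  forall (disp : measure_display) (Om : measurableType disp)
    (P : probability Om R) (eta : R -> Om -> lattice d -> nat),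
  irw_process p rho P eta ->
  ((N%:R ^- d)%:E *
   \int[lebesgue_measure]_(t in `[0%R, T]) \int[lebesgue_measure]_(s in `[0%R, T])
     'E_P[fun w => (fluctuation_field rho N x (eta (N%:R ^+ 2 * t)%R w) phi *
                    fluctuation_field rho N x (eta (N%:R ^+ 2 * s)%R w) phi)%R]
   <= (C * N%:R `^ (- (2 * (k%:R - 1) * d%:R) / (2 + (k%:R - 1) * d%:R)))%:E)%E.
Proof.
move=> T T0; case: k hk x => [//|k] _ x.
have [Kh Kh0 heat_le] := heat_kernel_bound hp.
have [Cs Cs0 sum_le] := schwartz_lattice_sum hphi.
have [b b0 phi_le] : exists2 b, 0 <= b & forall y, `|phi y| <= b.
  have [b b0 hb] := schwartz_decay hphi; exists b => // y; apply: le_trans (hb y) _.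
  rewrite ler_piMr// prodr_ile1// => i _; rewrite invr_ge0 addr_ge0 ?sqr_ge0//=.
  by rewrite invf_le1 ?lerDl ?sqr_ge0// ltr_pwDl ?sqr_ge0.
set K := rho^-1 * k`!%:R * rho^-1 ^+ k * k.+1%:R * b * Cs.
have K0 : 0 <= K by rewrite !mulr_ge0 ?exprn_ge0 ?invr_ge0 ?(ltW hrho).
exists (K * T * (2 + T * Kh ^+ k)).
exists 1%N => // N /= N1 disp Om P eta [Y hW].
have Np : 0 < N%:R :> R by rewrite ltr0n.
set e : R := - (2 * _ * _) / _.
have eE : e = - (2 * (d * k)%:R) / (2 + (d * k)%:R).
  by rewrite /e -[k.+1%:R]natr1 addrK natrM [d%:R * _]mulrC mulrA.
set E := N%:R `^ e; have E0 : 0 < E by rewrite powR_gt0.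
have mean_le u v M : 0 <= u -> 0 <= v -> (forall y z, heat_kernel p `|v - u| y z <= M) ->
    ('E_P[fun w => (fluctuation_field rho N x (eta u w) phi *
                    fluctuation_field rho N x (eta v w) phi)%R]
     <= (K * N%:R ^+ d * M ^+ k)%:E)%E.
  wlog uv : u v / u <= v => [hwlog u0 v0 hM|u0 v0 hM].
    have [uv|vu] := leP u v; first exact: hwlog.
    rewrite (_ : (fun w => _) = fun w => fluctuation_field rho N x (eta v w) phi *
                    fluctuation_field rho N x (eta u w) phi).
      by apply: hwlog => //; [exact: ltW|move=> y z; rewrite distrC].
    by apply/funext => w; rewrite mulrC.
  rewrite ger0_norm ?subr_ge0// in hM; rewrite unlock.
  have h := field_mean_le hp hrho hW x u0 uv hM phi_le (sum_le N N1).
  apply: (le_trans h).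
  by rewrite lee_fin /K exprMn le_eqVlt; apply/orP; left; apply/eqP; ring.
pose B := K * N%:R ^+ d; pose W := (Kh * Num.sqrt (N%:R ^+ 2 * E) ^- d) ^+ k.
have B0 : 0 <= B by rewrite mulr_ge0// exprn_ge0.
have W0 : 0 <= W by rewrite exprn_ge0// mulr_ge0// invr_ge0 exprn_ge0// sqrtr_ge0.
have WE : W = Kh ^+ k * E.
  rewrite /W exprMn; congr (_ * _).
  by rewrite -exprVn -exprM exprVn /E eE optimal_cutoff.
have pointwise t s : 0 <= t -> 0 <= s ->
    ('E_P[fun w => (fluctuation_field rho N x (eta (N%:R ^+ 2 * t)%R w) phi *
                    fluctuation_field rho N x (eta (N%:R ^+ 2 * s)%R w) phi)%R]
    <= B%:E * ((\1_`](t - E)%R, (t + E)%R[ s)%:E + W%:E))%E.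
  move=> t0 s0; have nt : 0 <= N%:R ^+ 2 * t by rewrite mulr_ge0// sqr_ge0.
  have ns : 0 <= N%:R ^+ 2 * s by rewrite mulr_ge0// sqr_ge0.
  rewrite indicE; case: (boolP (s \in _)) => [_|far].
    apply: le_trans (mean_le _ _ 1 nt ns _) _.
      by move=> y z; apply: heat_kernel_le1.
    by rewrite expr1n mulr1 -EFinD -EFinM lee_fin ler_peMr// lerDl.
  (* far from the diagonal the heat kernel bound applies with time lag at least N^2 E *)
  have gap : E <= `|s - t|.
    rewrite leNgt; apply/negP => near; move/negP: far; apply.
    rewrite inE /= in_itv /=; move: near; rewrite ltr_norml; lra.
  apply: le_trans (mean_le _ _ (Kh * Num.sqrt (N%:R ^+ 2 * E) ^- d) nt ns _) _; last first.
    by rewrite -EFinD -EFinM lee_fin add0r.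
  move=> y z; rewrite -mulrBr normrM ger0_norm ?sqr_ge0//.
  have gap0 : 0 < N%:R ^+ 2 * `|s - t| by rewrite mulr_gt0 ?exprn_gt0// (lt_le_trans E0).
  apply: le_trans (heat_le _ _ _ gap0) _; rewrite ler_wpM2l//.
  rewrite lef_pV2 ?posrE ?exprn_gt0 ?sqrtr_gt0 ?(mulr_gt0 (exprn_gt0 2 Np) E0)//.
  by rewrite lerXn2r ?nnegrE ?sqrtr_ge0// ler_wsqrtr// ler_wpM2l// sqr_ge0.
have RHS_E : K * T * (2 + T * Kh ^+ k) * E = N%:R ^- d * (B * (2 * E + T * W) * T).
  rewrite WE /B; field; rewrite expf_neq0// gt_eqF//.
rewrite RHS_E EFinM.
rewrite lee_wpmul2l ?lee_fin ?invr_ge0 ?exprn_ge0//.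
apply: (@le_trans _ _ (\int[lebesgue_measure]_(t in `[0%R, T]) (B * (2 * E + T * W))%:E)%E).
    apply: le_integral_ge0 => t /=; rewrite in_itv /= => /andP[t0 _].
      by rewrite lee_fin mulr_ge0// addr_ge0 ?mulr_ge0 ?(ltW E0) ?(ltW T0).
    apply: le_trans (integral_near_diagonal t (ltW T0) E0 B0 W0).
    apply: le_integral_ge0 => s /=; rewrite in_itv /= => /andP[s0 _].
      by rewrite mule_ge0 ?adde_ge0 ?lee_fin.
    exact: pointwise.
  rewrite integral_cst//.
  apply: (@le_trans _ _ ((B * (2 * E + T * W))%:E * lebesgue_measure `[0%R, T])%E) => //.
  by rewrite lebesgue_measure_itv /= lte_fin T0 -EFinB subr0 -EFinM.
Qed.
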